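(* Let $G=K_{n_1,n_2,\dots,n_r}$ be a complete multipartite graph, where $r\geq 3$ and $1\leq n_1\leq n_2\leq\dots\leq n_r$. Set $t=n_r$. Then $$px_3(G)=\begin{cases}3 & \text{if } G=K_{1,1,t} \text{ with } 5\leq t\leq 18,\ \text{or } G=K_{1,2,t} \text{ with } t\geq 13,\ \text{or } G=K_{1,1,1,t} \text{ with } t\geq 15;\\ \left\lceil\sqrt{\tfrac{t}{2}}\,\right\rceil & \text{if } G=K_{1,1,t} \text{ with } t\geq 19;\\ 2 & \text{otherwise.}\end{cases}$$
   Context: All graphs are simple, finite, undirected and connected. $K_{n_1,\dots,n_r}$ denotes the complete $r$-partite graph with partite sets of sizes $n_1,\dots,n_r$ (two vertices are adjacent if and only if they lie in different partite sets). An edge-coloring of a graph $G$ is any map $c:E(G)\to\{1,\dots,m\}$, $m\in\mathbb{N}$ (adjacent edges may receive the same color). A tree $T$ that is a subgraph of an edge-colored graph $G$ is a proper tree if no two adjacent edges of $T$ are assigned the same color. For $S\subseteq V(G)$, an $S$-tree is a tree that is a subgraph of $G$ and contains all vertices of $S$. For a connected graph $G$ of order $n$ and an integer $k$ with $2\le k\le n$, a $k$-proper coloring of $G$ is an edge-coloring such that for every set $S$ of $k$ vertices of $G$ there exists a proper $S$-tree in $G$. The $k$-proper index $px_k(G)$ is the minimum number of colors required in a $k$-proper coloring of $G$. *)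

(* Defs.v *)
From HB Require Import structures.
From mathcomp Require Import all_boot all_order all_algebra.
From mathcomp Require Import reals.
Set Implicit Arguments.
Unset Strict Implicit.
Unset Printing Implicit Defensive.

Record sgraph := SGraph {
  vertex :> finType;
  adj : rel vertex;
  adj_sym : symmetric adj;
  adj_irrefl : irreflexive adj }.

Section ProperIndex.
Variable G : sgraph.

Definition edges : {set {set G}} :=
  [set e : {set G} | [exists x, exists y, adj x y && (e == [set x; y])]].

Definition edge : finType := {e : {set G} | e \in edges}.

(* A subgraph of G is a pair (V, F) of a set of vertices and a set of edges
   satisfying is_subgraph V F. *)
Definition is_subgraph (V : {set G}) (F : {set edge}) : Prop :=
  forall e, e \in F -> val e \subset V.

Definition sub_adj (F : {set edge}) : rel G :=
  fun x y => [exists e in F, val e == [set x; y]].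

(* For a subgraph (V, F), walks along F starting in V stay in V. *)
Definition is_connected (V : {set G}) (F : {set edge}) : Prop :=
  V != set0 /\ forall x y, x \in V -> y \in V -> connect (sub_adj F) x y.

(* The size bound excludes the closed walk x, y, x along a single edge, which
   ucycle accepts as the sequence [:: x; y]. *)
Definition is_acyclic (F : {set edge}) : Prop :=
  forall s : seq G, 3 <= size s -> ~ ucycle (sub_adj F) s.

Definition is_tree (V : {set G}) (F : {set edge}) : Prop :=
  [/\ is_subgraph V F, is_connected V F & is_acyclic F].

Definition is_proper (m : nat) (c : edge -> 'I_m) (F : {set edge}) : Prop :=
  forall e f, e \in F -> f \in F -> e != f -> val e :&: val f != set0 ->
  c e != c f.

Definition k_proper_coloring (k m : nat) (c : edge -> 'I_m) : Prop :=
  forall S : {set G}, #|S| = k ->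
  exists (V : {set G}) (F : {set edge}),
    [/\ is_tree V F, S \subset V & is_proper c F].

End ProperIndex.

(* px_k(G) = m. A relation rather than a function, as the minimum need not
   exist when G is disconnected. *)
Definition is_proper_index (k : nat) (G : sgraph) (m : nat) : Prop :=
  (exists c : edge G -> 'I_m, k_proper_coloring k c) /\
  (forall (m' : nat) (c : edge G -> 'I_m'), k_proper_coloring k c -> m <= m').

Section CompleteMultipartite.
Variable ns : seq nat.

(* A vertex is a pair of the index i of its part and a position in that part,
   which has size ns_i. *)
Definition multipartite_vertex : finType :=
  {i : 'I_(size ns) & 'I_(nth 0 ns i)}.

Definition multipartite_adj : rel multipartite_vertex :=
  fun u v => tag u != tag v.

Lemma multipartite_adj_sym : symmetric multipartite_adj.
Proof. by move=> u v; rewrite /multipartite_adj eq_sym. Qed.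

Lemma multipartite_adj_irrefl : irreflexive multipartite_adj.
Proof. by move=> u; rewrite /multipartite_adj eqxx. Qed.

Definition complete_multipartite : sgraph :=
  SGraph multipartite_adj_sym multipartite_adj_irrefl.

End CompleteMultipartite.

(* The ceiling is a nonnegative integer, so absz only converts it to nat. *)
Definition ceil_sqrt_half (R : realType) (t : nat) : nat :=
  absz (Num.ceil (Num.sqrt (t%:R / 2%:R : R))%R).

(* Main.v *)
Require Import Defs.
From mathcomp Require Import all_boot all_order all_algebra.
From mathcomp Require Import reals.
From mathcomp Require Import zify.
Set Implicit Arguments.
Unset Strict Implicit.
Unset Printing Implicit Defensive.

(* A proper tree colored with two colors is an alternating path.  Let W be the
   largest part, of size t, and P its complement.
   If the parts can be grouped into two sides with at least four vertices each,
   the graph contains the blow-up of an alternating 4-cycle with all four blocks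
   of size at least 2, and going around it gives an alternating path through any
   three vertices; the remaining graphs with |P| >= 4 have at most 9 vertices.
   If |P| <= 3, a vertex of W has as type the vector of the colors of its edges
   to P.  For two colors, an alternating path through three vertices of W passes
   through the middle one with two different colors and uses distinct elements
   of P around it; this leaves at most two vertices in each of 2 classes of
   types for K_{1,1,t}, of 6 classes for K_{1,2,t} and of 7 classes for
   K_{1,1,1,t}, and the colorings that fill these classes are 3-proper.  With
   three colors, types taken from a Latin square work for K_{1,2,t} and
   K_{1,1,1,t}.  For K_{1,1,t} and any number m of colors, three vertices of the
   same type lie in no proper tree, hence t <= 2m^2; conversely, if each type
   occurs at most twice and all pairs of distinct colors occur, any three
   vertices lie in a double star whose centers are joined through a vertex with
   two different colors. *)

(** * Trees built by attaching leaves *)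

Section Grown.
Variables (T : eqType) (adj : rel T) (col : T -> T -> nat).

(* A proper tree given by its root and its edges (parent, child), the most
   recently attached leaf first. *)
Fixpoint grown (r : T) (s : seq (T * T)) : bool :=
  if s is (x, y) :: s' then
    [&& grown r s', x \in r :: unzip2 s', y \notin r :: unzip2 s', adj x y &
      all (fun e => (x \in [:: e.1; e.2]) ==> (col e.1 e.2 != col x y)) s']
  else true.

Lemma grown_src r s e : grown r s -> e \in s -> e.1 \in r :: unzip2 s.
Proof.
elim: s => //= -[x y] s IHs /and5P[gs xs ys _ _].
rewrite inE => /orP[/eqP-> /= | es].
  by move: xs; rewrite !inE => /orP[-> // | ->]; rewrite !orbT.
by have := IHs gs es; rewrite !inE => /orP[-> // | ->]; rewrite !orbT.
Qed.

Lemma grown_uniq r s : grown r s -> uniq (r :: unzip2 s).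
Proof.
elim: s => //= -[x y] s IHs /and5P[/IHs /= /andP[rs us] _ + _ _].
by rewrite !inE !negb_or eq_sym => /andP[-> ->]; rewrite rs us.
Qed.

End Grown.

Lemma grown_map (T T' : eqType) (adj : rel T) (adj' : rel T') col col'
    (g : T -> T') r s :
  {in r :: unzip2 s &, injective g} ->
  {in r :: unzip2 s &, forall x y, adj x y -> adj' (g x) (g y)} ->
  {in r :: unzip2 s &, forall x y, col' (g x) (g y) = col x y} ->
  grown adj col r s ->
  grown adj' col' (g r) [seq (g e.1, g e.2) | e <- s].
Proof.
elim: s => //= -[x y] s IHs gI gA gC gr; case/and5P: (gr) => gs xs ys axy axs.
have sub z : z \in r :: unzip2 s -> z \in r :: y :: unzip2 s.
  by rewrite !inE => /orP[->|->]; rewrite ?orbT.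
have xD := sub _ xs; have yD : y \in r :: y :: unzip2 s by rewrite !inE eqxx orbT.
have e2 : unzip2 [seq (g e.1, g e.2) | e <- s] = map g (unzip2 s).
  by rewrite /unzip2 -!map_comp.
have memg z : z \in r :: y :: unzip2 s ->
    (g z \in g r :: unzip2 [seq (g e.1, g e.2) | e <- s]) = (z \in r :: unzip2 s).
  move=> zD; rewrite e2 -map_cons; apply/mapP/idP => [[z' z's] | zs]; last by exists z.
  by move/gI => ->//; apply: sub.
rewrite IHs /= ?memg // ?gA //; try by move=> ? ? ? ?; auto.
- rewrite xs ys /= all_map; apply/allP => e es /=; have := allP axs _ es.
  have e1D := sub _ (grown_src gs es).
  have e2D : e.2 \in r :: y :: unzip2 s.
    by apply: sub; rewrite inE (map_f snd es) orbT.
  rewrite !inE !gC // => /implyP h; apply/implyP => /orP[] /eqP /gI E; apply: h.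
    by rewrite E ?eqxx.
  by rewrite E ?eqxx ?orbT.
Qed.

Section Trees.
Variable G : sgraph.
Implicit Types (F : {set edge G}) (V : {set G}).

Lemma mem_edges (x y : G) : adj x y -> [set x; y] \in edges G.
Proof. by move=> a; rewrite inE; apply/existsP; exists x; apply/existsP; exists y; rewrite a /=. Qed.

Lemma edge_ex (e : edge G) : exists x y : G, adj x y /\ val e = [set x; y].
Proof.
case: e => e /= p; move: (p); rewrite inE => /existsP[x /existsP[y /andP[a /eqP E]]].
by exists x, y.
Qed.

Lemma set2_eq (x y x' y' : G) : [set x; y] = [set x'; y'] ->
  (x = x' /\ y = y') \/ (x = y' /\ y = x').
Proof.
move=> E.
have /set2P hx: x \in [set x'; y'] by rewrite -E set21.
have /set2P hy: y \in [set x'; y'] by rewrite -E set22.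
have /set2P hx': x' \in [set x; y] by rewrite E set21.
have /set2P hy': y' \in [set x; y] by rewrite E set22.
by case: hx hy hx' hy' => E1 [] E2 [] E3 [] E4; subst; auto.
Qed.

Lemma sub_adjP F x y :
  reflect (exists2 e, e \in F & val e = [set x; y]) (sub_adj F x y).
Proof.
by apply: (iffP exists_inP) => -[e eF /eqP]; exists e => //; apply/eqP.
Qed.

Lemma sub_adj_sym F : symmetric (sub_adj F).
Proof. by move=> x y; rewrite /sub_adj setUC. Qed.

Lemma sub_adj_adj F x y : sub_adj F x y -> adj x y.
Proof.
case/sub_adjP => e _ E; case: (edge_ex e) => u [v [a]].
by rewrite E => /set2_eq[[-> ->]|[-> ->]] //; rewrite adj_sym.
Qed.

(** On a cycle through the leaf [y], both neighbors of [y] would be [x], while the vertices of a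
    cycle of length at least 3 are distinct; a cycle avoiding [y] lies in [F]. *)
Lemma leaf_acyclic F (e : edge G) x y V :
  is_subgraph V F -> y \notin V -> val e = [set x; y] ->
  is_acyclic F -> is_acyclic (e |: F).
Proof.
move=> sub yV Ee ac s ss /andP[cs us].
have step u v : sub_adj (e |: F) u v -> u != y -> v != y -> sub_adj F u v.
  case/sub_adjP => f /setU1P[-> | fF] Ef uy vy; last by apply/sub_adjP; exists f.
  by move: uy vy; rewrite Ee in Ef; case/set2_eq: Ef => -[_ ->]; rewrite eqxx.
have aty v : sub_adj (e |: F) y v -> v = x.
  case/sub_adjP => f /setU1P[-> | fF] Ef.
    rewrite Ee in Ef; case/set2_eq: Ef => -[xy yv]; last by [].
    by rewrite -yv.
  by have /subsetP/(_ y) := sub _ fF; rewrite Ef set21 (negPf yV) => /(_ isT).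
have [ys | ys] := boolP (y \in s); last first.
  apply: (ac s ss); apply/andP; split=> //.
  apply: (sub_in_cycle (P := [in s])) cs => [u v us' vs' /step h|].
    by apply: h; apply: contraNneq ys => <-.
  by apply/allP.
have [i s' Er] := rot_to ys.
have := us; rewrite -(rot_uniq i) Er; have := cs; rewrite -(rot_cycle i) Er.
have := ss; rewrite -(size_rot i) Er.
case: s' {Er} => [|a [|b s']] //= _ /andP[/aty-> /andP[_]].
rewrite rcons_path => /andP[_]; rewrite sub_adj_sym => /aty E.
case/andP=> _ /andP[] /negP[]; have := mem_last b s'.
by rewrite E.
Qed.

(** Links the lists checked by [grown] to trees as pairs of sets. A new edge can meet earlier edges
    only at its parent, because its child is not yet in the tree. *)
Lemma grown_tree (m : nat) (col : G -> G -> nat) (c : edge G -> 'I_m) r s :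
  (forall e x y, val e = [set x; y] -> c e = col x y :> nat) ->
  grown (@adj G) col r s ->
  exists (V : {set G}) (F : {set edge G}),
    [/\ is_tree V F, {subset r :: unzip2 s <= V} & is_proper c F].
Proof.
move=> cE gs.
suff [F [tF FE pF]] : exists F, [/\ is_tree [set z in r :: unzip2 s] F,
    (forall e, e \in F -> exists2 p, p \in s & val e = [set p.1; p.2])
    & is_proper c F].
  by exists [set z in r :: unzip2 s], F; split=> // z zs; rewrite inE.
elim: s gs => [|[x y] s IHs] /=.
  move=> _; exists set0; split; last by move=> e f; rewrite inE.
    split=> [e|| t]; first by rewrite inE.
      split; first by apply/set0Pn; exists r; rewrite !inE eqxx.
      by move=> u v; rewrite !inE => /eqP-> /eqP->; apply: connect0.
    case: t => // a t _; rewrite /ucycle /=; case: t => [|b t] /andP[] /andP[] /sub_adjP[e];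
    by rewrite inE.
  by move=> e; rewrite inE.
case/and5P=> /IHs[F [[sF [V0 cF] aF] FE pF]] xs ys axy cols.
pose e : edge G := exist _ [set x; y] (mem_edges axy).
set V := [set z in _] in sF V0 cF.
have VE : [set z in [:: r, y & unzip2 s]] = y |: V.
  by apply/setP=> z; rewrite !inE orbCA.
have xV : x \in V by rewrite inE.
have yV : y \notin V by rewrite inE.
exists (e |: F); rewrite VE; split.
- split.
  + move=> f /setU1P[-> | /sF fV]; apply/subsetP => z.
      by rewrite /= => /set2P[]->; rewrite !inE ?eqxx // -in_cons xs orbT.
    by move/(subsetP fV) => zV; rewrite inE zV orbT.
  + split; first by apply/set0Pn; exists y; rewrite setU11.
    have sc u v : connect (sub_adj F) u v -> connect (sub_adj (e |: F)) u v.
      apply: connect_sub => a b /sub_adjP[f fF Ef]; apply: connect1.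
      by apply/sub_adjP; exists f => //; rewrite setU1r.
    have xy : connect (sub_adj (e |: F)) x y.
      by apply/connect1/sub_adjP; exists e; rewrite ?setU11.
    have yx : connect (sub_adj (e |: F)) y x.
      by apply: connect1; rewrite sub_adj_sym; apply/sub_adjP; exists e; rewrite ?setU11.
    move=> u v /setU1P[->|uV] /setU1P[->|vV].
    * exact: connect0.
    * by apply: connect_trans yx _; apply/sc/cF.
    * by apply: connect_trans xy; apply/sc/cF.
    * exact/sc/cF.
  + exact: (leaf_acyclic sF yV).
- move=> f /setU1P[-> | /FE[p ps Ep]]; first by exists (x, y); rewrite ?mem_head.
  by exists p; rewrite // inE ps orbT.
have key f : f \in F -> val e :&: val f != set0 -> c e != c f.
  move=> fF /set0Pn[z /setIP[/set2P ze zf]].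
  have zV := subsetP (sF _ fF) _ zf.
  have zx : z = x by case: ze => // zy; rewrite zy (negPf yV) in zV.
  have [p ps Ep] := FE _ fF; have := allP cols _ ps.
  rewrite -zx; move: zf; rewrite Ep !inE => -> /=; rewrite zx => h.
  by rewrite -val_eqE /= (cE e x y erefl) (cE f _ _ Ep) eq_sym.
move=> f g /setU1P[->|fF] /setU1P[->|gF] fg I; rewrite ?eqxx // in fg *.
- exact: key.
- by rewrite eq_sym key // setIC.
- exact: pF.
Qed.

End Trees.

(** * Vertices as natural numbers *)

Definition colorable (G : sgraph) (m : nat) : Prop :=
  exists c : edge G -> 'I_m, k_proper_coloring 3 c.

(** A form of 3-proper colorability in which trees are lists and can be computed with; pairs that
    are not edges receive colors as well. *)
Definition nat_coloring (n : nat) (a : rel nat) (m : nat)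
    (col : nat -> nat -> nat) : Prop :=
  [/\ forall i j, col i j < m,
      forall i j, col i j = col j i &
      forall i j k, i < j < k -> k < n ->
      exists r s, [/\ grown a col r s, {in r :: unzip2 s, forall v, v < n}
                    & {subset [:: i; j; k] <= r :: unzip2 s}]].

Lemma cards3 (T : finType) (S : {set T}) : #|S| = 3 ->
  exists x y z, [/\ S = [set x; y; z], x != y, y != z & z != x].
Proof.
move=> S3; have /card_gt2P[x [y [z [[xS yS zS] [xy yz zx]]]]] : 2 < #|S| by rewrite S3.
exists x, y, z; split=> //; apply/esym/eqP; rewrite eqEcard S3 -setUA !cardsU1 cards1 !inE.
rewrite (eq_sym x z) (negPf zx) (negPf xy) (negPf yz) andbT.
by apply/subsetP => w; rewrite !inE => /or3P[] /eqP->.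
Qed.

(** Adjacency is carried over in one direction only, so a coloring of a spanning subgraph suffices:
    the trees found there are trees of [G], and the remaining edges may have any color. *)
Lemma nat_coloring_colorable (G : sgraph) n (idx : G -> nat) (g : nat -> G) (a : rel nat) m col :
  injective idx -> (forall i, i < n -> idx (g i) = i) -> (forall x, idx x < n) ->
  (forall x y, a (idx x) (idx y) -> adj x y) ->
  nat_coloring n a m col -> colorable G m.
Proof.
move=> idxI gK idxn aE [cm csym ctree].
have Kg x : g (idx x) = x by apply: idxI; rewrite gK.
have m0 : 0 < m by apply: leq_ltn_trans (cm 0 0).
(* By symmetry of [col] it does not matter in which order the endpoints are picked; the default is
   never reached. *)
pose c (e : edge G) := if [pick p : G * G | val e == [set p.1; p.2]] is Some p
  then Ordinal (cm (idx p.1) (idx p.2)) else Ordinal m0.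
have cE e x y : val e = [set x; y] -> c e = col (idx x) (idx y) :> nat.
  move=> Ee; rewrite /c; case: pickP => [[u v] /= /eqP | /(_ (x, y))]; last by rewrite Ee eqxx.
  by rewrite Ee => /set2_eq[[-> ->] | [-> ->]].
exists c => S /cards3[x [y [z [-> xy yz zx]]]].
have [r [s [gs sn sS]]] : exists r s, [/\ grown a col r s,
   {in r :: unzip2 s, forall v, v < n} & {subset [:: idx x; idx y; idx z] <= r :: unzip2 s}].
  have tri i j k : i < j < k -> k < n -> exists r s, [/\ grown a col r s,
      {in r :: unzip2 s, forall v, v < n} & {subset [:: i; j; k] <= r :: unzip2 s}].
    exact: ctree.
  have perm i j k i' j' k' : {subset [:: i; j; k] <= [:: i'; j'; k']} ->
     i' < j' < k' -> k' < n -> exists r s, [/\ grown a col r s,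
      {in r :: unzip2 s, forall v, v < n} & {subset [:: i; j; k] <= r :: unzip2 s}].
    move=> sub h k'n; have [r [s [h1 h2 h3]]] := tri _ _ _ h k'n.
    by exists r, s; split=> // t /sub/h3.
  have := idxn x; have := idxn y; have := idxn z.
  have : idx x != idx y by rewrite (inj_eq idxI).
  have : idx y != idx z by rewrite (inj_eq idxI).
  have : idx z != idx x by rewrite (inj_eq idxI).
  move: (idx x) (idx y) (idx z) => i j k; rewrite !neq_ltn => H1 H2 H3 kn jn In.
  have sort i' j' k' : i' < j' < k' -> k' < n -> perm_eq [:: i; j; k] [:: i'; j'; k'] ->
      exists r s, [/\ grown a col r s,
      {in r :: unzip2 s, forall v, v < n} & {subset [:: i; j; k] <= r :: unzip2 s}].
    by move=> h k'n /perm_mem E; apply: perm h k'n => t; rewrite E.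
  have [lij|lij] := ltnP i j; have [ljk|ljk] := ltnP j k; have [lik|lik] := ltnP i k;
    try lia.
  - by apply: (sort i j k); rewrite ?lij.
  - by apply: (sort i k j) => //; [lia | apply/permP => p /=; lia].
  - by apply: (sort k i j) => //; [lia | apply/permP => p /=; lia].
  - by apply: (sort j i k) => //; [lia | apply/permP => p /=; lia].
  - by apply: (sort j k i) => //; [lia | apply/permP => p /=; lia].
  - by apply: (sort k j i) => //; [lia | apply/permP => p /=; lia].
have [||V [F [tF sV pF]]] := @grown_tree G m (fun u v => col (idx u) (idx v)) c
    (g r) [seq (g e.1, g e.2) | e <- s].
- exact: cE.
- apply: grown_map gs.
  + by move=> i j /sn ni /sn nj /(congr1 idx); rewrite !gK.
  + by move=> i j /sn ni /sn nj aij; apply: aE; rewrite !gK.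
  + by move=> i j /sn ni /sn nj; rewrite !gK.
exists V, F; split=> //; apply/subsetP => w ws; apply: sV.
have : idx w \in r :: unzip2 s.
  by apply: sS; move: ws; rewrite !inE => /orP[/orP[]|] /eqP->; rewrite eqxx ?orbT.
move/(map_f g); rewrite Kg /= /unzip2 -!map_comp; apply.
Qed.

(** * Complete multipartite graphs as intervals separated by cuts *)

Section Multipartite.
Variable ns : seq nat.
Implicit Types u v : complete_multipartite ns.

Definition vindex u : nat := flatten_index ns (tag u) (tagged u).

Lemma vindex_lt u : vindex u < sumn ns.
Proof.
case: u => i x /=; rewrite /vindex /flatten_index /=.
have := ltn_ord x; have := ltn_ord i => ins.
rewrite -[X in _ < sumn X](cat_take_drop i.+1) sumn_cat (take_nth 0) // sumn_rcons.
by move=> xn; apply: ltn_addr; rewrite ltn_add2l.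
Qed.

Lemma vindex_inj : injective vindex.
Proof.
case=> i x [j y]; rewrite /vindex /= => E.
have Ei : i = j.
  by apply/val_inj; rewrite /= -(flatten_indexKl (ltn_ord x)) E (flatten_indexKl (ltn_ord y)).
case: j / Ei y E => y E; congr (Tagged _ _).
by apply/val_inj; rewrite /= -(flatten_indexKr (ltn_ord x)) E (flatten_indexKr (ltn_ord y)).
Qed.

Lemma vindex_onto : 0 < sumn ns ->
  exists g : nat -> complete_multipartite ns, forall i, i < sumn ns -> vindex (g i) = i.
Proof.
move=> n0.
have ex i : i < sumn ns -> exists u, vindex u = i.
  move=> h; pose u : complete_multipartite ns :=
    Tagged (fun k : 'I_(size ns) => 'I_(nth 0 ns k))
      (Ordinal (reshape_offsetP h) : 'I_(nth 0 ns (Ordinal (reshape_indexP h)))).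
  by exists u; rewrite /vindex /= reshape_indexK.
have [u0 _] := ex _ n0.
exists (fun i => odflt u0 [pick u | vindex u == i]) => i /ex[u Eu].
by case: pickP => [v /eqP //| /(_ u)]; rewrite Eu eqxx.
Qed.

Definition psums := [seq sumn (take k ns) | k <- iota 0 (size ns).+1].

End Multipartite.

(* In the ordering of the vertices by parts, i < j lie in different parts if
   and only if a part begins between them. *)
Definition cut_adj (cuts : seq nat) : rel nat :=
  fun i j => has (fun c => (i < c <= j) || (j < c <= i)) cuts.

Lemma sumn_take_mono (ns : seq nat) i j : i <= j -> sumn (take i ns) <= sumn (take j ns).
Proof. by move=> ij; rewrite -(subnKC ij) takeD sumn_cat leq_addr. Qed.

Lemma multipartite_adjE ns (u v : complete_multipartite ns) :
  adj u v = cut_adj (psums ns) (vindex u) (vindex v).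
Proof.
have cutP (p : pred nat) : has p (psums ns) = has (fun k => p (sumn (take k ns))) (iota 0 (size ns).+1).
  by rewrite /psums has_map.
rewrite /cut_adj cutP; case: u v => i x [j y].
have xi := ltn_ord x; have yj := ltn_ord y.
have S (k : 'I_(size ns)) : sumn (take k.+1 ns) = sumn (take k ns) + nth 0 ns k.
  by rewrite (take_nth 0) // sumn_rcons.
rewrite /vindex /flatten_index [LHS]/= /multipartite_adj ![tag _]/= ![tagged _]/=.
apply/idP/hasP => [ij | [k _ h]].
  (* The start of the later of the two parts separates the two numbers. *)
  have [lt|lt] : i < j \/ j < i.
  + by apply/orP; rewrite -neq_ltn.
  + exists (val j); first by rewrite mem_iota /= add0n ltnW // ltnS ltn_ord.
    have := sumn_take_mono ns lt; rewrite S; move: xi yj => /=; lia.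
  + exists (val i); first by rewrite mem_iota /= add0n ltnW // ltnS ltn_ord.
    have := sumn_take_mono ns lt; rewrite S; move: xi yj => /=; lia.
apply/eqP => E; case: j / E y yj h => y yj h.
have [ki|ik] := leqP k i.
  by have := sumn_take_mono ns ki; move: h => /=; lia.
by have := sumn_take_mono ns ik; rewrite S; move: xi yj h => /=; lia.
Qed.

(** Leaving out cuts merges neighboring parts, which only removes edges; hence a coloring for fewer
    cuts is enough. *)
Lemma cut_coloring_colorable ns cuts m col :
  0 < sumn ns -> {subset cuts <= psums ns} ->
  nat_coloring (sumn ns) (cut_adj cuts) m col ->
  colorable (complete_multipartite ns) m.
Proof.
move=> n0 sub nc; have [g gK] := vindex_onto n0.
apply: (nat_coloring_colorable (@vindex_inj ns) gK (@vindex_lt ns) _ nc) => x y.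
rewrite multipartite_adjE => /hasP[c cc h].
by apply/hasP; exists c => //; apply: sub.
Qed.

(** Counting the vertices backwards makes the first numbers, the hubs of [table_col], come from the
    end of [ns]. *)
Lemma rev_cut_coloring_colorable ns cuts m col :
  0 < sumn ns -> {subset [seq sumn ns - c | c <- cuts] <= psums ns} ->
  all (leq^~ (sumn ns)) cuts ->
  nat_coloring (sumn ns) (cut_adj cuts) m col ->
  colorable (complete_multipartite ns) m.
Proof.
move=> n0 sub cn nc; have [g gK] := vindex_onto n0.
pose idx (u : complete_multipartite ns) := sumn ns - (vindex u).+1.
have lt := @vindex_lt ns.
apply: (@nat_coloring_colorable _ (sumn ns) idx (fun i => g (sumn ns - i.+1)) _ _ _ _ _ _ _ nc).
- by move=> u v; rewrite /idx => E; apply: vindex_inj; have := lt u; have := lt v; lia.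
- by move=> i h; rewrite /idx gK; lia.
- by move=> u; rewrite /idx; have := lt u; lia.
move=> u v; rewrite multipartite_adjE => /hasP[c cc]; rewrite /idx => h.
apply/hasP; exists (sumn ns - c); first by apply/sub/map_f.
by have := allP cn _ cc; have := lt u; have := lt v; lia.
Qed.

(** * Paths and finite checks *)

Section ProperPaths.
Variables (T : eqType) (adj : rel T) (col : T -> T -> nat).
Hypothesis col_sym : forall x y, col x y = col y x.
Hypothesis adj_sym : symmetric adj.

Fixpoint proper_seq (s : seq T) : bool :=
  if s is x :: ((y :: s'') as s') then
    [&& adj x y, (if s'' is z :: _ then col x y != col y z else true) & proper_seq s']
  else true.

(** The root is the last vertex of the path and the others are attached backwards, since [grown]
    lists the most recent leaf first; a new edge meets only the edge attached just before it. *)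
Lemma proper_seq_grown x s : uniq (x :: s) -> proper_seq (x :: s) ->
  exists r es, grown adj col r es /\ r :: unzip2 es =i x :: s.
Proof.
move=> us ps; pose pt := fix pt (s : seq T) : seq (T * T) :=
  if s is x :: ((y :: s'') as s') then (y, x) :: pt s' else [::].
have ptE x' y s' : pt [:: x', y & s'] = (y, x') :: pt (y :: s') by [].
have pt_sub e x' s' : e \in pt (x' :: s') -> e.1 \in s' /\ e.2 \in x' :: s'.
  elim: s' x' => [|y s' IHs] x' //; rewrite ptE inE => /orP[/eqP-> | /IHs[e1 e2]].
    by rewrite !inE !eqxx.
  by rewrite [e.2 \in _]in_cons !inE e1 -in_cons e2 !orbT.
exists (last x s), (pt (x :: s)).
elim: s x us ps => [|y s IHs] x //.
move=> /andP[xs us] /and3P[xy cxy ps]; have [gs E] := IHs y us ps.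
split; last first.
  by move=> z; have := E z; rewrite ptE /= !inE => {}E; rewrite orbCA E.
rewrite ptE; apply/and5P; split=> //; rewrite ?E ?mem_head // 1?adj_sym //.
apply/allP => e; case: s {IHs gs E xs ps} us cxy => [|z s] // /andP[ys _] cxy.
rewrite ptE inE => /orP[/eqP-> /= | /pt_sub[e1 e2]].
  by apply/implyP => _; rewrite [col z y]col_sym [col y x]col_sym eq_sym.
apply/implyP; rewrite !inE => /orP[] /eqP ye; move: ys; rewrite ye ?e2 //.
by rewrite inE e1 orbT.
Qed.

(** Hangs a star at the vertex [x] of a tree. The last clause of the conclusion records the origin
    of the edges, so that a second star can be hung at another vertex. *)
Lemma attach_grown r s x l : grown adj col r s -> x \in r :: unzip2 s ->
  uniq (l ++ r :: unzip2 s) -> all (adj x) l -> uniq (map (col x) l) ->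
  (forall e y, e \in s -> x \in [:: e.1; e.2] -> y \in l -> col e.1 e.2 != col x y) ->
  exists s', [/\ grown adj col r s', r :: unzip2 s' =i l ++ r :: unzip2 s &
    forall e, e \in s' -> e \in s \/ exists2 y, y \in l & e = (x, y)].
Proof.
move=> gs xs ul al cl cs; exists ([seq (x, y) | y <- l] ++ s).
elim: l ul al cl cs => [|y l IHl]; first by move=> *; split=> //; left.
rewrite cat_cons map_cons => /andP[yl ul] /andP[xy al] /andP[yc cl] cs.
have [||||gs' E eE] := IHl => //.
  by move=> e z es xe zl; apply: cs => //; rewrite inE zl orbT.
split.
- apply/and5P; split=> //.
  + by rewrite E mem_cat xs orbT.
  + by rewrite E.
  apply/allP => e /eE[es|[z zl ->]]; apply/implyP => xe.
    by apply: cs => //; rewrite mem_head.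
  by apply: contraNneq yc => /= <-; apply: map_f.
- by move=> z; have := E z; rewrite !inE /= => {}E; rewrite orbCA E.
move=> e; rewrite inE => /orP[/eqP-> | /eE[|[z zl ->]]]; [|by left|].
  by right; exists y; rewrite ?mem_head.
by right; exists z; rewrite // inE zl orbT.
Qed.

End ProperPaths.

Lemma cut_adj_sym cuts : symmetric (cut_adj cuts).
Proof. by move=> i j; apply: eq_has => c; rewrite orbC. Qed.

Lemma path_nat_coloring n cuts m col :
  (forall i j, col i j < m) -> (forall i j, col i j = col j i) ->
  (forall i j k, i < j < k -> k < n -> exists s,
     [/\ uniq s, proper_seq (cut_adj cuts) col s, all (gtn n) s & {subset [:: i; j; k] <= s}]) ->
  nat_coloring n (cut_adj cuts) m col.
Proof.
move=> cm csym H; split=> // i j k ijk kn.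
have [[|x s] [us ps /allP sn sub]] := H i j k ijk kn; first by have := sub i (mem_head _ _).
have [r [es [gs E]]] := proper_seq_grown csym (@cut_adj_sym cuts) us ps.
by exists r, es; split=> // v; rewrite E; [apply: sn | apply: sub].
Qed.

(* s is a path in reverse order.  The conditionals and find stand for ||, &&
   and has, which call-by-value evaluation would not short-circuit. *)
Fixpoint path_search (n : nat) (a : rel nat) (col : nat -> nat -> nat)
    (target : seq nat) (fuel : nat) (s : seq nat) : bool :=
  if all [in s] target then true else
  if fuel < count (fun v => v \notin s) target then false else
  if fuel is fuel'.+1 then
    (* With one step left, only a target can complete the path. *)
    let l := target ++ if fuel' == 0 then [::] else iota 0 n in
    find (fun v => if v \in s then false else
                   if proper_seq a col (v :: take 2 s)
                   then path_search n a col target fuel' (v :: s) else false)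
         l < size l
  else false.

(** Fuel 6 allows paths with up to seven vertices, the most that a path can have when all but three
    vertices form an independent set. Starting at one of the three given vertices is no restriction,
    as the ends of a path can be cut off. *)
Definition triple_search (n : nat) (a : rel nat) (col : nat -> nat -> nat) : bool :=
  all (fun k => all (fun j => all (fun i =>
    find (fun v => path_search n a col [:: i; j; k] 6 [:: v]) [:: i; j; k] < 3)
  (iota 0 j)) (iota 0 k)) (iota 0 n).

Lemma path_searchP n a col target fuel s : all (gtn n) target ->
  path_search n a col target fuel s -> uniq s -> proper_seq a col s -> all (gtn n) s ->
  exists s', [/\ uniq s', proper_seq a col s', all (gtn n) s' & {subset target <= s'}].
Proof.
move=> /allP tn; elim: fuel s => [|fuel IHf] s /=.
  by case: ifP => [/allP ts _ us ps sn | _]; [exists s | case: ifP].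
case: ifP => [/allP ts _ us ps sn | _]; first by exists s.
case: ifP => // _; rewrite -has_find => /hasP[v vl].
have vn : v < n.
  by move: vl; rewrite mem_cat => /orP[/tn // |]; case: ifP => // _; rewrite mem_iota.
case: ifP => // /negbT vs; case: ifP => // pv.
move=> /IHf H us ps sn; apply: H; rewrite /= ?vs ?us ?vn //.
by case: s pv ps {vs us sn} => [|x [|y s]] //= /and3P[-> -> _] ->.
Qed.

Lemma triple_search_coloring n cuts m col :
  (forall i j, col i j < m) -> (forall i j, col i j = col j i) ->
  triple_search n (cut_adj cuts) col -> nat_coloring n (cut_adj cuts) m col.
Proof.
move=> cm csym /allP H; apply: path_nat_coloring => // i j k /andP[ij jk] kn.
have iot x y : x < y -> x \in iota 0 y by rewrite mem_iota.
have := allP (allP (H k (iot _ _ kn)) j (iot _ _ jk)) i (iot _ _ ij).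
rewrite -has_find => /hasP[v vt].
have tn : all (gtn n) [:: i; j; k] by rewrite /=; lia.
by move/(path_searchP tn); apply=> //=; rewrite andbT; apply: (allP tn).
Qed.

(* Every type in {0,1}^3 but 000 and 111 occurs twice, and then come two
   vertices of type 111. *)
Definition type_table : seq (seq nat) :=
  [:: [:: 0; 0; 1]; [:: 1; 1; 0]; [:: 0; 1; 0]; [:: 1; 0; 1]; [:: 1; 0; 0]; [:: 0; 1; 1];
      [:: 0; 0; 1]; [:: 1; 1; 0]; [:: 0; 1; 0]; [:: 1; 0; 1]; [:: 1; 0; 0]; [:: 0; 1; 1];
      [:: 1; 1; 1]; [:: 1; 1; 1]].

Definition table_col (i j : nat) : nat :=
  if minn i j < 3 <= maxn i j
  then nth 0 (nth [::] type_table (maxn i j - 3)) (minn i j) else 0.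

Lemma table_col_sym i j : table_col i j = table_col j i.
Proof. by rewrite /table_col minnC maxnC. Qed.

Lemma table_col_lt i j : table_col i j < 2.
Proof.
rewrite /table_col; case: ifP => // _; move: (minn i j) (maxn i j - 3) => p q.
have [lt|ge] := ltnP q (size type_table); last by rewrite [nth [::] _ _]nth_default ?nth_nil.
have : nth [::] type_table q \in type_table by apply: mem_nth.
move: (nth _ _ q) => l; have [lp|gp] := ltnP p (size l); last by rewrite nth_default.
move/(allP (isT : all (all (gtn 2)) type_table))/allP; apply; exact: mem_nth.
Qed.

(** In this order: $K_{3,3}$ to $K_{3,12}$; $K_{1,1,1,t}$ for $t = 1, 2, 13, 14$; $K_{1,2,2}$;
    $K_{3,1,1}$, a subgraph of $K_5$; $K_{2,2,2}$. *)
Definition table_graphs : seq (nat * seq nat) :=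
  [seq (n, [:: 3]) | n <- iota 6 10] ++
    [:: (4, [:: 1; 2; 3]); (5, [:: 1; 2; 3]); (16, [:: 1; 2; 3]); (17, [:: 1; 2; 3]);
        (5, [:: 1; 3]); (5, [:: 3; 4]); (6, [:: 2; 4])].

Lemma table_coloring n cuts :
  (n, cuts) \in table_graphs ->
  nat_coloring n (cut_adj cuts) 2 table_col.
Proof.
move=> nc; apply: triple_search_coloring.
- exact: table_col_lt.
- exact: table_col_sym.
have table_ok : all (fun t => triple_search t.1 (cut_adj t.2) table_col) table_graphs.
  by vm_compute.
exact: (allP table_ok _ nc).
Qed.

(** * Blow-ups *)

(** Pads the members of [S] in a class with elements of the default list [d], so that a selection of
    prescribed size covers them. *)
Lemma extend_selection (T : eqType) (Q : pred T) (S d : seq T) :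
  uniq S -> count Q S <= size d -> uniq d -> all Q d ->
  exists l, [/\ size l = size d, uniq l, all Q l & {in S, forall x, Q x -> x \in l}].
Proof.
move=> uS cS ud Qd; set l := filter Q S ++ [seq x <- d | x \notin filter Q S].
exists (take (size d) l).
have lS : size (filter Q S) <= size d by rewrite size_filter.
have ul : uniq l.
  rewrite cat_uniq filter_uniq //= filter_uniq // andbT.
  by apply/hasPn => x; rewrite mem_filter => /andP[].
have Ql : all Q l.
  rewrite all_cat filter_all; apply/allP => x; rewrite mem_filter => /andP[_].
  exact: (allP Qd).
split.
- rewrite size_takel //; apply: uniq_leq_size => // x xd.
  by rewrite mem_cat [X in _ || X]mem_filter xd andbT orbN.
- exact: take_uniq.
- by apply/allP => x /mem_take; apply: (allP Ql).
move=> x xS Qx; have xf : x \in filter Q S by rewrite mem_filter Qx.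
by rewrite take_cat ltnNge lS /= mem_cat xf.
Qed.

(* The parity of the block containing i, for the blow-up of a 4-cycle whose
   blocks {0, 1}, {p, p+1}, {2, ..., p-1}, {p+2, ...} alternate between the sides. *)
Definition half (p i : nat) : bool := (2 <= i < p) || (p + 2 <= i).

(** In the cyclic order {0, 1}, {p, p+1}, {2, ..., p-1}, {p+2, ...} of the blocks, the edges between
    consecutive blocks have colors 0, 1, 0, 1. *)
Definition c4_col (p i j : nat) : nat := half p i (+) half p j.

Arguments cut_adj : simpl never.
Arguments c4_col : simpl never.

(** A path going twice around the 4-cycle of blocks meets every block twice, which is enough unless
    one block contains all three vertices; in that case a ninth vertex, from that block, is put in
    front. *)
Lemma c4_coloring n p : 4 <= p -> p + 4 <= n ->
  nat_coloring n (cut_adj [:: p]) 2 (c4_col p).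
Proof.
move=> p4 pn; apply: path_nat_coloring => [i j|i j|i j k /andP[ij jk] kn].
- by rewrite /c4_col; case: (_ (+) _).
- by rewrite /c4_col addbC.
set S := [:: i; j; k]; have uS : uniq S by rewrite /= !inE; lia.
(* [Q s b] is the block on side [s] with parity [b]. *)
pose Q s b v := [&& v < n, (v < p) == s & half p v == b].
have sel s b : count (Q s b) S <= 2 -> exists x y, [/\ x != y, Q s b x, Q s b y &
    {in S, forall v, Q s b v -> v \in [:: x; y]}].
  move=> cS; pose d := if s then if b then [:: 2; 3] else [:: 0; 1]
     else if b then [:: p + 2; p + 3] else [:: p; p + 1].
  have sd : size d = 2 by rewrite /d; case: (s) (b) => -[].
  have [] // := @extend_selection _ (Q s b) S d uS.
  + by rewrite sd.
  + by rewrite /d; case: (s) (b) => -[] //=; rewrite !inE; lia.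
  + by rewrite /d /Q /half; case: (s) (b) => -[] /=; rewrite ?eqb_id ?eqbF_neg; lia.
  rewrite sd => -[|x [|y [|? ?]]] [] // _; rewrite /= inE.
  by case/andP=> xy _ /and3P[Qx Qy _] H; exists x, y.
have adjQ s b b' x y : Q s b x -> Q (~~ s) b' y -> cut_adj [:: p] x y.
  by rewrite /Q /cut_adj /=; case: s => /=; lia.
have colQ s s' b b' x y : Q s b x -> Q s' b' y -> c4_col p x y = b (+) b'.
  by move=> /and3P[_ _ /eqP hx] /and3P[_ _ /eqP hy]; rewrite /c4_col hx hy.
have neQ s s' b b' x y : Q s b x -> Q s' b' y -> (s, b) != (s', b') -> x != y.
  move=> /and3P[_ /eqP sx /eqP hx] /and3P[_ /eqP sy /eqP hy].
  by apply: contraNneq => xy; rewrite -sx -sy -hx -hy xy.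
have Qn s b x : Q s b x -> x < n by case/and3P.
(* Two rounds through the blocks; [e] gives the direction, as the first step keeps the parity
   exactly if [e] is false. *)
have path8 s b e x x' y y' z z' w w' : x != x' -> y != y' -> z != z' -> w != w' ->
    Q s b x -> Q s b x' -> Q (~~ s) (b (+) e) y -> Q (~~ s) (b (+) e) y' ->
    Q s (~~ b) z -> Q s (~~ b) z' -> Q (~~ s) (~~ (b (+) e)) w -> Q (~~ s) (~~ (b (+) e)) w' ->
    let t := [:: x; y; z; w; x'; y'; z'; w'] in
    [/\ uniq t, proper_seq (cut_adj [:: p]) (c4_col p) t & all (gtn n) t].
  move=> nx ny nz nw Qx Qx' Qy Qy' Qz Qz' Qw Qw'; split; last first.
  - by rewrite /= !(Qn _ _ _ Qx, Qn _ _ _ Qx', Qn _ _ _ Qy, Qn _ _ _ Qy', Qn _ _ _ Qz,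
      Qn _ _ _ Qz', Qn _ _ _ Qw, Qn _ _ _ Qw').
  - have Ns a b' v : Q a b' v -> Q (~~ ~~ a) b' v by rewrite negbK.
    rewrite /= !(adjQ _ _ _ _ _ Qx Qy, adjQ _ _ _ _ _ Qy (Ns _ _ _ Qz), adjQ _ _ _ _ _ Qz Qw,
      adjQ _ _ _ _ _ Qw (Ns _ _ _ Qx'), adjQ _ _ _ _ _ Qx' Qy', adjQ _ _ _ _ _ Qy' (Ns _ _ _ Qz'),
      adjQ _ _ _ _ _ Qz' Qw').
    rewrite !(colQ _ _ _ _ _ _ Qx Qy, colQ _ _ _ _ _ _ Qy Qz, colQ _ _ _ _ _ _ Qz Qw,
      colQ _ _ _ _ _ _ Qw Qx', colQ _ _ _ _ _ _ Qx' Qy', colQ _ _ _ _ _ _ Qy' Qz',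
      colQ _ _ _ _ _ _ Qz' Qw').
    by case: (b) (e) => -[].
  rewrite /= !inE !negb_or.
  repeat match goal with |- is_true (_ && _) => apply/andP; split end;
    try assumption; try exact: isT;
    match goal with H : is_true (Q _ _ ?u), H' : is_true (Q _ _ ?v) |- is_true (?u != ?v) =>
      by apply: (neQ _ _ _ _ _ _ H H'); case: (s) (b) (e) => -[] [] end.
have [full | sparse] := boolP [exists s, exists b, all (Q s b) S].
  have /existsP[s /existsP[b /and4P[Qi Qj Qk _]]] := full.
  have sel0 s' b' : (s', b') != (s, b) -> exists x y, [/\ x != y, Q s' b' x & Q s' b' y].
    move=> ne; have [|x [y []]] := sel s' b'; last by exists x, y.
    have no v : Q s b v -> Q s' b' v = false.
      by move=> Qv; apply/negP => Qv'; have := neQ _ _ _ _ _ _ Qv' Qv ne; rewrite eqxx.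
    by rewrite /= !no.
  have [|y [y' [ny Qy Qy']]] := sel0 (~~ s) b; first by case: (s) (b) => -[].
  have [|z [z' [nz Qz Qz']]] := sel0 s (~~ b); first by case: (s) (b) => -[].
  have [|w [w' [nw Qw Qw']]] := sel0 (~~ s) (~~ b); first by case: (s) (b) => -[].
  have jk' : j != k by clear -jk; lia.
  have [||||||||||||ut pt nt] := @path8 (~~ s) b true y y' z z' w w' j k; rewrite ?negbK ?addbT ?negbK //.
  (* The common block of [i], [j], [k] is visited at the start, in the middle and at the end. *)
  exists [:: i, y, z, w, j, y', z', w' & [:: k]]; split.
  + rewrite cons_uniq ut andbT !inE !negb_or.
    have [ij' ik'] : i != j /\ i != k by clear -ij jk; lia.
    repeat match goal with |- is_true (_ && _) => apply/andP; split end;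
    try assumption; try exact: isT;
    match goal with H : is_true (Q _ _ ?u), H' : is_true (Q _ _ ?v) |- is_true (?u != ?v) =>
      by apply: (neQ _ _ _ _ _ _ H H'); case: (s) (b) => -[] end.
  + apply/and3P; split=> //; first exact: adjQ Qi Qy.
    by rewrite (colQ _ _ _ _ _ _ Qi Qy) (colQ _ _ _ _ _ _ Qy Qz); case: (b).
  + by rewrite /= (Qn _ _ _ Qi).
  + by move=> v; rewrite !inE => /or3P[] ->; rewrite ?orbT.
have cS s b : count (Q s b) S <= 2.
  move: sparse; rewrite negb_exists => /forallP/(_ s); rewrite negb_exists => /forallP/(_ b).
  by rewrite /=; case: (Q s b i) (Q s b j) (Q s b k) => -[] [].
have [x [x' [nx Qx Qx' Sx]]] := sel _ _ (cS true true).
have [y [y' [ny Qy Qy' Sy]]] := sel _ _ (cS false true).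
have [z [z' [nz Qz Qz' Sz]]] := sel _ _ (cS true false).
have [w [w' [nw Qw Qw' Sw]]] := sel _ _ (cS false false).
have [||||||||||||ut pt nt] := @path8 true true false x x' y y' z z' w w' => //.
exists [:: x; y; z; w; x'; y'; z'; w']; split=> // v vS.
have vn : v < n by move: vS; rewrite !inE; clear -ij jk kn; lia.
have : Q (v < p) (half p v) v by rewrite /Q vn !eqxx.
case: (v < p) (half p v) => -[] Qv.
- by have := Sx _ vS Qv; rewrite !inE => /orP[]->; rewrite ?orbT.
- by have := Sz _ vS Qv; rewrite !inE => /orP[]->; rewrite ?orbT.
- by have := Sy _ vS Qv; rewrite !inE => /orP[]->; rewrite ?orbT.
- by have := Sw _ vS Qv; rewrite !inE => /orP[]->; rewrite ?orbT.
Qed.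

(* The types of the vertices outside {0, 1, 2} are the rows of a Latin square. *)
Lemma latin_coloring n : 12 <= n ->
  nat_coloring n (cut_adj [:: 3]) 3 (fun i j => (i + j) %% 3).
Proof.
move=> n12; split=> [i j|i j|i j k /andP[ij jk] kn]; [exact: ltn_pmod | by rewrite addnC |].
set S := [:: i; j; k]; have uS : uniq S by rewrite /= !inE; lia.
pose Q q v := [&& 3 <= v, v < n & v %% 3 == q %% 3].
(* Each class modulo 3 has three members among 3, ..., 11, all below [n] by [n12]. *)
have selQ q l : size l <= 3 -> count (Q q) S <= size l ->
    l = take (size l) [:: 3 + q %% 3; 6 + q %% 3; 9 + q %% 3] ->
    exists l', [/\ size l' = size l, uniq l', all (Q q) l' & {in S, forall x, Q q x -> x \in l'}].
  move=> l3 cl El; apply: extend_selection => //.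
    by rewrite El take_uniq //= !inE; lia.
  have q3 : q %% 3 < 3 by rewrite ltn_pmod.
  rewrite El; apply/allP => x /mem_take; rewrite !inE /Q => /or3P[] /eqP->; lia.
(* At most one class contains two or more of the three vertices; [q] is taken to be that class if
   there is one, with indices read modulo 3. *)
have [q [c1 c2]] : exists q, count (Q q.+1) S <= 1 /\ count (Q q.+2) S <= 1.
  have Q1 v : Q 0 v + Q 1 v + Q 2 v <= 1 by rewrite /Q; clear; lia.
  have : count (Q 0) S + count (Q 1) S + count (Q 2) S <= 3.
    by rewrite /=; move: (Q1 i) (Q1 j) (Q1 k); clear; lia.
  have Q3 : count (Q 3) S = count (Q 0) S by [].
  have Q4 : count (Q 4) S = count (Q 1) S by [].
  have [c1|c1] := leqP (count (Q 1) S) 1; have [c2|c2] := leqP (count (Q 2) S) 1 => c012.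
  - by exists 0.
  - exists 2; rewrite Q3 Q4 c1; split=> //; move: c012 c2.
    by move: (count _ S) (count _ S) (count _ S); clear; lia.
  - exists 1; rewrite Q3 c2; split=> //; move: c012 c1.
    by move: (count _ S) (count _ S) (count _ S); clear; lia.
  - move: c012 c1 c2; move: (count _ S) (count _ S) (count _ S); clear; lia.
have [//||//|l [sl ul Ql Sl]] := selQ q [:: 3 + q %% 3; 6 + q %% 3; 9 + q %% 3].
  exact: count_size.
case: l sl ul Ql Sl => [|a [|a' [|a'' [|? ?]]]] // _.
rewrite /= !inE !negb_or => /and3P[/andP[aa' aa''] a'a'' _] /and4P[Qa Qa' Qa'' _] Sa.
have [//|//|//|l [sl _ Ql Sl]] := selQ q.+1 [:: 3 + q.+1 %% 3].
case: l sl Ql Sl => [|b [|? ?]] // _ /andP[Qb _] Sb.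
have [//|//|//|l [sl _ Ql Sl]] := selQ q.+2 [:: 3 + q.+2 %% 3].
case: l sl Ql Sl => [|c [|? ?]] // _ /andP[Qc _] Sc.
(* The spine 0, b, 1, c, 2 has the colors q+1, q+2, q, q+1 modulo 3, and the leaves a, a', a'' at 0,
   1, 2 have q, q+1, q+2; the colors at each vertex are distinct. *)
exists 0, [:: (2, a''); (1, a'); (0, a); (c, 2); (1, c); (b, 1); (0, b)].
split.
- have cutl x v : x < 3 -> 3 <= v -> cut_adj [:: 3] x v by rewrite /cut_adj /=; lia.
  have cutr x v : x < 3 -> 3 <= v -> cut_adj [:: 3] v x by rewrite /cut_adj /=; lia.
  case/and3P: Qa => a3 _ /eqP aq; case/and3P: Qa' => a'3 _ /eqP a'q.
  case/and3P: Qa'' => a''3 _ /eqP a''q; case/and3P: Qb => b3 _ /eqP bq.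
  case/and3P: Qc => c3 _ /eqP cq.
  rewrite /= !inE !(cutl 0 b, cutr 1 b, cutl 1 c, cutr 2 c, cutl 0 a, cutl 1 a', cutl 2 a'') //.
  clear -aa' aa'' a'a'' a3 a'3 a''3 b3 c3 aq a'q a''q bq cq.
  repeat match goal with |- is_true (_ && _) => apply/andP; split end; try exact: isT; lia.
- move=> v; case/and3P: Qa => _ na _; case/and3P: Qa' => _ na' _; case/and3P: Qa'' => _ na'' _.
  case/and3P: Qb => _ nb _; case/and3P: Qc => _ nc _.
  by rewrite /= !inE; clear -na na' na'' nb nc n12; lia.
move=> v vS.
have [v3|v3] := ltnP v 3; first by rewrite /= !inE; clear -v3; lia.
have vn : v < n by move: vS; rewrite !inE; clear -ij jk kn; lia.
have [vq|vq|vq] : [\/ Q q v, Q q.+1 v | Q q.+2 v].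
- have : [\/ v %% 3 = q %% 3, v %% 3 = q.+1 %% 3 | v %% 3 = q.+2 %% 3].
    clear; have : (v %% 3 = q %% 3 \/ v %% 3 = q.+1 %% 3) \/ v %% 3 = q.+2 %% 3 by lia.
    by case=> [[]|]; [constructor 1 | constructor 2 | constructor 3].
  by case=> E; [constructor 1 | constructor 2 | constructor 3]; rewrite /Q v3 vn E eqxx.
- by have := Sa v vS vq; rewrite /= !inE => /or3P[] ->; rewrite ?orbT.
- by have := Sb v vS vq; rewrite /= !inE => ->; rewrite ?orbT.
- by have := Sc v vS vq; rewrite /= !inE => ->; rewrite ?orbT.
Qed.

(** * Colorings of K_{1,1,t} *)

Section DoubleStar.
Variables (n m : nat) (a b : nat -> nat).
Hypotheses (am : forall i, a i < m) (bm : forall i, b i < m).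

(** The hubs are 0 and 1, and [(a v, b v)] is the type of a vertex [v >= 2]. *)
Definition pair_col (i j : nat) : nat :=
  if maxn i j < 2 then 0 else
  if minn i j == 0 then a (maxn i j) else if minn i j == 1 then b (maxn i j) else 0.

Lemma pair_col_lt i j : pair_col i j < m.
Proof. by rewrite /pair_col; do 3?case: ifP => _ //; apply: leq_ltn_trans (am 0). Qed.

Lemma pair_col_sym i j : pair_col i j = pair_col j i.
Proof. by rewrite /pair_col minnC maxnC. Qed.

Lemma pair_col0 v : 2 <= v -> pair_col 0 v = a v.
Proof. by move=> v2; rewrite /pair_col max0n min0n ltnNge v2. Qed.

Lemma pair_col1 v : 2 <= v -> pair_col 1 v = b v.
Proof.
move=> v2; have v1 := ltnW v2.
by rewrite /pair_col (maxn_idPr v1) (minn_idPl v1) ltnNge v2.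
Qed.

(** The centers 0 and 1 are joined through [w] and carry the leaves [U] and [V]. The conditions on
    the colors of [w] also keep it out of [U] and [V]. *)
Lemma double_star_grown U V w : all (fun v => 2 <= v < n) (w :: U ++ V) ->
  uniq (U ++ V) -> uniq (map a U) -> uniq (map b V) ->
  a w \notin map a U -> b w \notin map b V -> a w != b w ->
  exists r s, [/\ grown (cut_adj [:: 1; 2]) pair_col r s,
    {in r :: unzip2 s, forall v, v < n} & {subset [:: 0, 1 & U ++ V] <= r :: unzip2 s}].
Proof.
move=> /= /andP[/andP[w2 wn] /allP UV] uUV uU uV wU wV ab.
have U2 v : v \in U -> 2 <= v by move=> vU; have /andP[]: 2 <= v < n by apply: UV; rewrite mem_cat vU.
have V2 v : v \in V -> 2 <= v by move=> vV; have /andP[]: 2 <= v < n by apply: UV; rewrite mem_cat vV orbT.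
have adj0 v : 2 <= v -> cut_adj [:: 1; 2] 0 v by rewrite /cut_adj /=; lia.
have adj1 v : 2 <= v -> cut_adj [:: 1; 2] 1 v by rewrite /cut_adj /=; lia.
have g0 : grown (cut_adj [:: 1; 2]) pair_col 0 [:: (w, 1); (0, w)].
  rewrite /= !inE eqxx orbT adj0 // cut_adj_sym adj1 // pair_col0 // pair_col_sym pair_col1 // ab.
  by rewrite !implybT; move: w2; case: (w) => [|[]].
have wU' : w \notin U by apply: contra wU => /(map_f a).
have wV' : w \notin V by apply: contra wV => /(map_f b).
have mapU : map (pair_col 0) U = map a U by apply/eq_in_map => v /U2 /pair_col0.
have mapV : map (pair_col 1) V = map b V by apply/eq_in_map => v /V2 /pair_col1.
have notU v : v < 2 -> v \notin U by move=> v2; apply/negP => /U2; rewrite leqNgt v2.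
have notV v : v < 2 -> v \notin V by move=> v2; apply/negP => /V2; rewrite leqNgt v2.
move: uUV; rewrite cat_uniq => /and3P[uU' /hasPn VU uV'].
have [|||||s1 [g1 E1 s1E]] := attach_grown (l := U) g0 (x := 0).
- by rewrite mem_head.
- rewrite cat_uniq uU' /= !inE !negb_or (notU 0) // (notU 1) // wU' /=.
  by move: w2; case: (w) => [|[]].
- by apply/allP => v /U2 /adj0.
- by rewrite mapU.
- move=> e y; rewrite !inE => /orP[]/eqP-> /= e0 yU.
    by move: w2; case: (w) e0 => [|[]].
  rewrite (pair_col0 w2) (pair_col0 (U2 _ yU)); apply: contraNneq wU => ->; exact: map_f.
have E1' v : (v \in 0 :: unzip2 s1) = [|| v \in U, v == 0, v == 1 | v == w].
  by rewrite E1 mem_cat !inE.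
have [|||||s2 [g2 E2 s2E]] := attach_grown (l := V) g1 (x := 1).
- by rewrite E1' eqxx !orbT.
- rewrite cat_uniq uV' (grown_uniq g1) andbT andTb.
  apply/hasPn => v; rewrite E1' => /or4P[vU|/eqP->|/eqP->|/eqP-> //]; try exact: notV.
  by apply: contraL vU => /VU.
- by apply/allP => v /V2 /adj1.
- by rewrite mapV.
- move=> e y /s1E[|[z zU ->]].
    rewrite !inE => /orP[] /eqP-> /= e1 yV.
      rewrite pair_col_sym (pair_col1 w2) (pair_col1 (V2 _ yV)); apply: contraNneq wV => ->; exact: map_f.
    by move: w2; case: (w) e1 => [|[]].
  by rewrite !inE /= => /eqP z1; have := U2 _ zU; rewrite -z1.
have E2' v : (v \in 0 :: unzip2 s2) = [|| v \in V, v \in U, v == 0, v == 1 | v == w].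
  by rewrite E2 mem_cat E1'.
exists 0, s2; split=> // v; rewrite E2'.
- have wn' : 1 < n := leq_trans w2 (ltnW wn).
  case/or4P => [vV|vU|/eqP->|/orP[]/eqP-> //]; last exact: ltnW.
  + by have /andP[] : 2 <= v < n by apply: UV; rewrite mem_cat vV orbT.
  + by have /andP[] : 2 <= v < n by apply: UV; rewrite mem_cat vU.
by rewrite !inE mem_cat => /or4P[]->; rewrite ?orbT.
Qed.

Hypothesis m3 : 3 <= m.
Hypothesis all_pairs : forall x y, x < m -> y < m -> x != y ->
  exists w, [/\ 2 <= w < n, a w = x & b w = y].
Hypothesis no_triple : forall i j k, 2 <= i -> i < j < k -> k < n ->
  ~ ([/\ a i = a j, b i = b j, a j = a k & b j = b k]).

Lemma fresh (l : seq nat) : size l < m -> exists2 x, x < m & x \notin l.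
Proof.
move=> lm; have /hasP[x] : has [predC l] (iota 0 m).
  rewrite has_predC; apply/negP => /allP sub.
  have := uniq_leq_size (iota_uniq 0 m) sub.
  by rewrite size_iota leqNgt lm.
by rewrite mem_iota => xm xl; exists x.
Qed.

(** The color at the hub with two forbidden colors is chosen first; the other hub then has to avoid
    one forbidden color and the chosen one, so three colors suffice. *)
Lemma link (X Y : seq nat) : size X + size Y <= 3 -> 0 < size X -> 0 < size Y ->
  exists w, [/\ 2 <= w < n, a w \notin X, b w \notin Y & a w != b w].
Proof.
move=> XY X0 Y0; have [x [y [xm ym xX yY xy]]] :
    exists x y, [/\ x < m, y < m, x \notin X, y \notin Y & x != y].
  have [Y1|Y2] := leqP (size Y) 1.
    have [|x xm xX] := @fresh X; first by lia.
    have [|y ym] := @fresh (x :: Y); first by rewrite /=; lia.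
    by rewrite inE negb_or => /andP[yx yY]; exists x, y; rewrite eq_sym.
  have [|y ym yY] := @fresh Y; first by lia.
  have [|x xm] := @fresh (y :: X); first by rewrite /=; lia.
  by rewrite inE negb_or => /andP[xy xX]; exists x, y.
by have [w [wn aw bw]] := all_pairs xm ym xy; exists w; rewrite aw bw.
Qed.

Lemma pair_coloring : nat_coloring n (cut_adj [:: 1; 2]) m pair_col.
Proof.
split=> [||i j k /andP[ij jk] kn]; [exact: pair_col_lt | exact: pair_col_sym |].
have tree U V : size U + size V <= 3 -> 0 < size U -> 0 < size V ->
    all (fun v => 2 <= v < n) (U ++ V) -> uniq (U ++ V) -> uniq (map a U) -> uniq (map b V) ->
    {subset [:: i; j; k] <= [:: 0, 1 & U ++ V]} ->
    exists r s, [/\ grown (cut_adj [:: 1; 2]) pair_col r s,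
      {in r :: unzip2 s, forall v, v < n} & {subset [:: i; j; k] <= r :: unzip2 s}].
  move=> sUV U0 V0 aUV uUV uU uV sub.
  have [|||w [wn wU wV ab]] := @link (map a U) (map b V); rewrite ?size_map //.
  have [|r [s [g1 g2 g3]]] := double_star_grown _ uUV uU uV wU wV ab; first by rewrite /= wn.
  by exists r, s; split=> // v /sub/g3.
(* Two of the vertices with different colors at a hub become leaves there, and the third goes to the
   other hub. Such a pair exists because the three types are not all equal. *)
have [i2|i2] := leqP 2 i.
  have [aij|aij] := eqVneq (a i) (a j); last first.
    apply: (tree [:: i; j] [:: k]); rewrite /= ?inE //; try lia.
    by move=> v; rewrite !inE => /or3P[]->; rewrite ?orbT.
  have [ajk|ajk] := eqVneq (a j) (a k); last first.
    apply: (tree [:: j; k] [:: i]); rewrite /= ?inE //; try lia.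
    by move=> v; rewrite !inE => /or3P[]->; rewrite ?orbT.
  have [bij|bij] := eqVneq (b i) (b j); last first.
    apply: (tree [:: k] [:: i; j]); rewrite /= ?inE //; try lia.
    by move=> v; rewrite !inE => /or3P[]->; rewrite ?orbT.
  apply: (tree [:: i] [:: j; k]); rewrite /= ?inE //; try lia.
    rewrite andbT; apply/negP => /eqP bjk.
    by apply: (@no_triple i j k) => //; rewrite ij.
  by move=> v; rewrite !inE => /or3P[]->; rewrite ?orbT.
have [j2|j2] := leqP 2 j.
  apply: (tree [:: j] [:: k]); rewrite /= ?inE //; try lia.
  by move=> v; rewrite !inE; lia.
(* Both hubs are among the three vertices; [w] merely gives hub 1 a leaf, and differs from [k] by
   its color at hub 0. *)
have [//|//|//|w [wn aw _ _]] := @link [:: a k] [:: a k].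
apply: (tree [:: k] [:: w]); rewrite /= ?inE //; try lia.
- by move: aw; rewrite inE andbT; apply: contraNneq => ->.
by move=> v; rewrite !inE; lia.
Qed.

End DoubleStar.

(** With [v - 2 = q * m + x], the type of [v] is [x] and [x + q + 1] modulo [m]. The rows
    [q < m - 1] run through all pairs of distinct colors, and there are at most [2 * m] rows. *)
Lemma latin_pair_coloring n m : 3 <= m -> m * m.-1 + 2 <= n -> n <= 2 * m ^ 2 + 2 ->
  nat_coloring n (cut_adj [:: 1; 2]) m
    (pair_col (fun v => (v - 2) %% m) (fun v => (v - 2 + (v - 2) %/ m + 1) %% m)).
Proof.
move=> m3 n_ge n_le; have m0 : 0 < m by lia.
apply: pair_coloring => // [v|v|x y xm ym xy|i j k i2 /andP[ij jk] kn]; try exact: ltn_pmod.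
  (* The row that contains the type [(x, y)]: [y - x - 1] modulo [m]. *)
  pose q := if x < y then y - x - 1 else m + y - x - 1.
  have [qm Eq] : q < m.-1 /\ (x + q + 1 = y \/ x + q + 1 = m + y).
    by rewrite /q; case: (ltnP x y) => h; move: h xy xm ym; clear; lia.
  exists (q * m + x + 2); rewrite addnK modnMDl divnMDl // (divn_small xm) addn0 modn_small //.
  have lt : q * m + x < m * m.-1.
    rewrite mulnC; apply: (@leq_trans (m.-2 * m + m)); last first.
      by rewrite -mulSnr mulnC leq_mul2l; apply/orP; right; lia.
    have : q * m <= m.-2 * m by rewrite leq_mul2r; apply/orP; right; clear -qm m3; lia.
    by move: xm; clear; lia.
  split=> //; first by apply/andP; split; lia.
  rewrite -!addnA modnMDl !addnA; case: Eq => ->; first exact: modn_small.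
  by rewrite modnDl modn_small.
case=> aij bij ajk bjk.
(* Vertices of equal type lie at least [m] rows apart, so a third one would lie in row [2 * m] or
   later. *)
have step v w : v < w -> (v - 2) %% m = (w - 2) %% m -> 2 <= v ->
    (v - 2 + (v - 2) %/ m + 1) %% m = (w - 2 + (w - 2) %/ m + 1) %% m ->
    (v - 2) %/ m + m <= (w - 2) %/ m.
  move=> vw E v2 /eqP; rewrite eqn_modDr => E2.
  have lt : (v - 2) %/ m < (w - 2) %/ m.
    rewrite ltnNge; apply/negP => le.
    have := divn_eq (v - 2) m; have := divn_eq (w - 2) m; rewrite E.
    have : (w - 2) %/ m * m <= (v - 2) %/ m * m by rewrite leq_mul2r le orbT.
    by move: vw v2; clear; lia.
  have : (v - 2) %/ m == (w - 2) %/ m %[mod m].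
    move: E2; rewrite -modnDml E modnDml -modnDml -[X in _ == X]modnDml.
    by rewrite eqn_modDl.
  rewrite eq_sym (eqn_mod_dvd _ (ltnW lt)) => /dvdn_leq; rewrite subn_gt0 => /(_ lt).
  by move: lt; clear; lia.
have h1 := step i j ij aij i2 bij.
have h2 := step j k jk ajk (leq_trans i2 (ltnW ij)) bjk.
have : (k - 2) %/ m < 2 * m by rewrite ltn_divLR // -mulnA mulnn; clear -n_le kn ij jk; lia.
by move: h1 h2; move: ((i - 2) %/ m) ((j - 2) %/ m) ((k - 2) %/ m); clear; lia.
Qed.

Lemma nth0_lt s m i : all (gtn m) (0 :: s) -> nth 0 s i < m.
Proof.
case/andP=> m0 /allP sm; have [lt|ge] := ltnP i (size s); last by rewrite nth_default.
exact/sm/mem_nth.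
Qed.

Lemma small_pair_coloring t : 1 <= t <= 4 ->
  exists col, nat_coloring (t + 2) (cut_adj [:: 1; 2]) 2 col.
Proof.
(* The vertices 2, 3, 4, 5 get the types (0,1), (0,0), (1,0), (1,1); the first two entries of each
   list belong to the hubs. *)
move=> t14; exists (pair_col (fun v => nth 0 [:: 0; 0; 0; 0; 1; 1] v) (fun v => nth 0 [:: 0; 0; 1; 0; 0; 1] v)).
apply: triple_search_coloring => [i j|i j|].
- by apply: pair_col_lt => v; apply: nth0_lt.
- exact: pair_col_sym.
by case: t t14 => [|[|[|[|[|t]]]]] //; vm_compute.
Qed.

(** [latin_pair_coloring] with three colors starts at six vertices outside the hubs, so five are
    treated by search. *)
Lemma five_pair_coloring : exists col, nat_coloring 7 (cut_adj [:: 1; 2]) 3 col.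
Proof.
exists (pair_col (fun v => nth 0 [:: 0; 0; 0; 0; 1; 1; 2] v) (fun v => nth 0 [:: 0; 0; 0; 1; 0; 2; 1] v)).
apply: triple_search_coloring => [i j|i j|].
- by apply: pair_col_lt => v; apply: nth0_lt.
- exact: pair_col_sym.
by vm_compute.
Qed.

(** * Lower bounds *)

Lemma card_classes (V : finType) (T : eqType) (W : {set V}) (k : V -> T) (l : seq T) :
  {in W, forall v, k v \in l} ->
  {in W & &, forall x y z, x != y -> y != z -> z != x -> k x = k y -> k y = k z -> False} ->
  #|W| <= 2 * size l.
Proof.
elim: l W => [|h l IHl] W kl three.
  by rewrite leqn0 cards_eq0; apply/set0Pn => -[v /kl].
have h2 : #|[set v in W | k v == h]| <= 2.
  rewrite leqNgt; apply/negP => /card_gt2P[x [y [z [[]]]]].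
  rewrite !inE => /andP[xW /eqP kx] /andP[yW /eqP ky] /andP[zW /eqP kz] [xy yz zx].
  by apply: (three x y z) => //; rewrite ?kx ?ky ?kz.
have := IHl (W :\: [set v in W | k v == h]).
rewrite -(cardsID [set v in W | k v == h] W) (setIidPr _); last first.
  by apply/subsetP => v; rewrite inE => /andP[].
rewrite mulnS => H; apply: leq_add => //; apply: H => [v|x y z].
  by rewrite !inE negb_and => /andP[/orP[/negPf-> // | kv] vW]; have := kl v vW; rewrite inE (negPf kv).
by rewrite !inE => /andP[_ xW] /andP[_ yW] /andP[_ zW]; apply: three.
Qed.

Section LowerBounds.
Variables (G : sgraph) (m : nat) (c : edge G -> 'I_m).
Implicit Types (F : {set edge G}) (V S P : {set G}).

Definition ecol (x y : G) : nat := oapp (fun e => c e : nat) 0 (insub [set x; y]).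

Lemma ecolE e x y : val e = [set x; y] -> ecol x y = c e.
Proof. by rewrite /ecol => <-; rewrite valK. Qed.

Lemma ecol_sym x y : ecol x y = ecol y x.
Proof. by rewrite /ecol setUC. Qed.

Lemma ecol_proper F x y z : is_proper c F -> sub_adj F x y -> sub_adj F y z -> x != z ->
  ecol x y != ecol y z.
Proof.
move=> pF /sub_adjP[e eF Ee] /sub_adjP[f fF Ef] xz.
rewrite (ecolE Ee) (ecolE Ef); apply: (pF e f eF fF).
  apply: contraNneq xz => ef; move: Ee; rewrite ef Ef => /set2_eq[[-> ->] // | [_ ->]].
  by [].
by apply/set0Pn; exists y; rewrite inE Ee Ef set22 set21.
Qed.

Lemma connected_edge V F x y : is_connected V F -> x \in V -> y \in V -> x != y ->
  exists z, sub_adj F x z.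
Proof.
move=> [_ cF] xV yV xy; have /connectP[[|z p] /= pp E] := cF x y xV yV.
  by rewrite E eqxx in xy.
by case/andP: pp => xz _; exists z.
Qed.

(** A connected subgraph with three vertices has two adjacent edges, and in a proper tree these
    differ in color. *)
Lemma proper_coloring_ge2 : 2 < #|G| -> k_proper_coloring 3 c -> 2 <= m.
Proof.
move=> /card_gt2P[x [y [z [_ [xy yz zx]]]]] pc.
have [|V [F [[sF cF aF] sV pF]]] := pc [set x; y; z].
  by rewrite -setUA !cardsU1 cards1 !inE negb_or xy (eq_sym x z) zx yz.
have xV : x \in V by apply: (subsetP sV); rewrite !inE eqxx.
have yV : y \in V by apply: (subsetP sV); rewrite !inE eqxx orbT.
have zV : z \in V by apply: (subsetP sV); rewrite !inE eqxx !orbT.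
have two u v w : sub_adj F u v -> sub_adj F v w -> u != w -> 2 <= m.
  move=> uv vw uw; have := ecol_proper pF uv vw uw.
  case/sub_adjP: uv => e _ /ecolE->; case/sub_adjP: vw => f _ /ecolE->.
  by move: (ltn_ord (c e)) (ltn_ord (c f)); clear; lia.
have edge v : v \in V -> v != x -> sub_adj F x v \/ 2 <= m.
  move=> vV vx; have [_ conn] := cF; have /connectP[p pp E] := conn x v xV vV.
  case/shortenP: pp E => -[|a [|b p']] //= pp up _ E.
  - by rewrite E eqxx in vx.
  - by left; rewrite E; case/andP: pp.
  right; case/and3P: pp => xa ab _; apply: two xa ab _.
  by case/and3P: up; rewrite !inE !negb_or => /and3P[].
have [|xy'|//] := edge y yV; first by rewrite eq_sym.
have [xz'|//] := edge z zV zx.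
by apply: (two y x z) => //; rewrite sub_adj_sym.
Qed.

(** Each of [x], [y], [z] has a tree edge to [p] or [q]. Two of them share a hub, where their edges
    are adjacent and have the same color. *)
Lemma same_type_two_hubs (p q x y z : G) : k_proper_coloring 3 c ->
  (forall u v, u \notin [set p; q] -> v \notin [set p; q] -> ~~ adj u v) ->
  x \notin [set p; q] -> y \notin [set p; q] -> z \notin [set p; q] ->
  x != y -> y != z -> z != x ->
  ecol x p = ecol y p -> ecol y p = ecol z p ->
  ecol x q = ecol y q -> ecol y q = ecol z q -> False.
Proof.
move=> pc indep xW yW zW xy yz zx xyp yzp xyq yzq.
have [|V [F [[sF cF aF] sV pF]]] := pc [set x; y; z].
  by rewrite -setUA !cardsU1 cards1 !inE negb_or xy (eq_sym x z) zx yz.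
have xV : x \in V by apply: (subsetP sV); rewrite !inE eqxx.
have yV : y \in V by apply: (subsetP sV); rewrite !inE eqxx orbT.
have zV : z \in V by apply: (subsetP sV); rewrite !inE eqxx !orbT.
have hub u v : u \in V -> v \in V -> u != v -> u \notin [set p; q] ->
    sub_adj F u p \/ sub_adj F u q.
  move=> uV vV uv uW; have [w uw] := connected_edge cF uV vV uv.
  have [/set2P[] E|wW] := boolP (w \in [set p; q]); rewrite ?E in uw; [by left | by right |].
  by have := indep u w uW wW; rewrite (sub_adj_adj uw).
have clash h u v : sub_adj F u h -> sub_adj F v h -> u != v -> ecol u h = ecol v h -> False.
  move=> uh vh uv E; rewrite sub_adj_sym in vh.
  by have := ecol_proper pF uh vh uv; rewrite E ecol_sym eqxx.
have zxp : ecol z p = ecol x p by rewrite xyp.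
have zxq : ecol z q = ecol x q by rewrite xyq.
have [xh|xh] := hub x y xV yV xy xW; have [yh|yh] := hub y z yV zV yz yW;
have [zh|zh] := hub z x zV xV zx zW;
  match goal with H : is_true (sub_adj F ?u ?h), H' : is_true (sub_adj F ?v ?h), ne : is_true (?u != ?v) |- _ =>
    by apply: (clash _ _ _ H H' ne) end.
Qed.

End LowerBounds.

Lemma proper_seq_catr (T : eqType) (a : rel T) col s1 s2 :
  proper_seq a col (s1 ++ s2) -> proper_seq a col s2.
Proof.
elim: s1 => // x s1 IHs; case: s1 IHs => [|y s1] IHs.
  by case: s2 {IHs} => // y s2 /= /and3P[].
by rewrite /= => /and3P[_ _]; exact: IHs.
Qed.

Lemma subseq_split (T : eqType) (x : T) t s : subseq (x :: t) s ->
  exists s1 s2, s = s1 ++ x :: s2 /\ subseq t s2.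
Proof.
elim: s => //= y s IHs; case: eqVneq => [-> ts | _ /IHs[s1 [s2 [-> ts]]]].
  by exists [::], s.
by exists (y :: s1), s2.
Qed.

(** * Alternating paths through three vertices of an independent set *)

Section Alternating.
Variables (T : eqType) (adj : rel T) (col : T -> T -> nat) (P : pred T).
Hypothesis indep : forall u v, ~~ P u -> ~~ P v -> ~~ adj u v.

(** Neighbors of a vertex outside [P] lie in [P]. Therefore the number of elements of [P] in a path
    segment between two vertices outside [P] nearly determines its shape. *)
Lemma segment_head a l u r : ~~ P a -> ~~ P u -> proper_seq adj col (a :: l ++ u :: r) ->
  exists x l', [/\ l = x :: l', P x & proper_seq adj col (x :: l' ++ u :: r)].
Proof.
case: l => [|x l] Pa Pu /= /and3P[au _ pl]; first by have := indep Pa Pu; rewrite au.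
exists x, l; split=> //; apply: contraLR au; exact: indep.
Qed.

Lemma segment0 x l u r : ~~ P u -> proper_seq adj col (x :: l ++ u :: r) -> count P l = 0 -> l = [::].
Proof.
case: l => // y l Pu; rewrite cat_cons => /and3P[_ _ pl] /eqP.
rewrite /= addn_eq0 eqb0 => /andP[Py /eqP cl].
by have [z [l' [E Pz _]]] := segment_head Py Pu pl; rewrite E /= Pz in cl.
Qed.

Lemma segment1 a l u r : ~~ P a -> ~~ P u -> proper_seq adj col (a :: l ++ u :: r) ->
  count P l = 1 -> exists2 x, P x & l = [:: x].
Proof.
move=> Pa Pu pl; have [x [l' [-> Px pl']]] := segment_head Pa Pu pl.
by rewrite /= Px => -[cl]; exists x; rewrite // (segment0 Pu pl' cl).
Qed.

Lemma segment2 a l u r : ~~ P a -> ~~ P u -> proper_seq adj col (a :: l ++ u :: r) ->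
  count P l = 2 -> exists x y, [/\ P x, P y &
    l = [:: x; y] \/ exists2 w, ~~ P w & l = [:: x; w; y]].
Proof.
move=> Pa Pu pl; have [x [l' [-> Px pl']]] := segment_head Pa Pu pl.
rewrite /= Px => -[cl]; case: l' cl pl' {pl} => // y l'; rewrite /= => cl /and3P[_ _ pl].
have [Py|Py] := boolP (P y).
  by move: cl; rewrite Py => -[cl]; exists x, y; rewrite (segment0 Pu pl cl); split=> //; left.
move: cl; rewrite (negPf Py) add0n => cl; have [z Pz ->] := segment1 Py Pu pl cl.
by exists x, z; split=> //; right; exists y.
Qed.

(* The colors seen by three vertices a, u, b outside P, in this order on an
   alternating 2-colored path, when P has at most three elements. *)
Definition alternation (a u b : T) : Prop := exists p q r,
  [/\ P p, P q, P r, p != q & p != r] /\ [/\ col a p != col u p, col u p != col u q &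
  col b r != col u q \/ [/\ r != q, adj q r & col b r = col u q]].

Hypothesis col_sym : forall x y, col x y = col y x.
Hypothesis adj_sym : symmetric adj.
Hypothesis col2 : forall x y, col x y < 2.

(** Both segments meet [P], so one of them is a single vertex [p]. In the other, [q] is next to [u]
    and [r] next to the far end. The colors at [q] and [r] differ if [q = r] or a vertex lies
    between them, and agree if [q] and [r] are consecutive. *)
Lemma proper_seq_alternation a l1 u l2 b r : ~~ P a -> ~~ P u -> ~~ P b ->
  proper_seq adj col (a :: l1 ++ u :: l2 ++ b :: r) -> uniq (l1 ++ l2) ->
  count P (l1 ++ l2) <= 3 -> alternation a u b \/ alternation b u a.
Proof.
move=> Pa Pu Pb ps; have ps2 := @proper_seq_catr _ _ _ (a :: l1) _ ps.
rewrite count_cat.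
have [x [l1' [E1 Px _]]] := segment_head Pa Pu ps.
have [y [l2' [E2 Py _]]] := segment_head Pu Pb ps2.
have c1 : 0 < count P l1 by rewrite E1 /= Px.
have c2 : 0 < count P l2 by rewrite E2 /= Py.
move=> ul cl; have {c1 c2 cl} := conj c1 (conj c2 cl).
(* If the first segment has two elements of [P], the path is read backwards. *)
have [c1|n1] := eqVneq (count P l1) 1; last first.
  move=> [c1 [c2 c12]]; right.
  have [z [w [Pz Pw El1]]] : exists x y, [/\ P x, P y &
      l1 = [:: x; y] \/ exists2 w, ~~ P w & l1 = [:: x; w; y]].
    by apply: segment2 ps _ => //; clear -n1 c1 c2 c12; lia.
  have [v Pv El2] : exists2 x, P x & l2 = [:: x].
    by apply: segment1 ps2 _ => //; clear -n1 c1 c2 c12; lia.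
  exists v, w, z; move: ul ps; rewrite El2.
  case: El1 => [->|[t _ ->]]; rewrite /= !inE !negb_or.
    case/and3P=> /andP[zw zv] wv _ /and5P[_ c1' azw c2' /and5P[_ c3' _ c4' _]].
    split; first by split; rewrite // eq_sym.
    split; [by rewrite (col_sym b) (col_sym u) in c4' * ; rewrite eq_sym
      | by rewrite (col_sym u w) eq_sym |].
    right; split; rewrite // 1?adj_sym // (col_sym u).
    by move: (col2 a z) (col2 z w) (col2 w u) c1' c2'; clear; lia.
  case/and4P=> /and3P[_ zw zv] _ wv _ /and5P[_ c1' _ c2' /and5P[_ c3' _ c4' /and3P[_ c5' _]]].
  split; first by split; rewrite // eq_sym.
  split; [by rewrite (col_sym b) eq_sym | by rewrite (col_sym u w) eq_sym |].
  left; rewrite (col_sym u).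
  by move: (col2 a z) (col2 z t) (col2 t w) (col2 w u) c1' c2' c3'; clear; lia.
move=> [_ [c2 c12]]; left; have [z Pz El1] := segment1 Pa Pu ps c1.
have [c21|n2] := eqVneq (count P l2) 1.
  have [w Pw El2] := segment1 Pu Pb ps2 c21.
  exists z, w, w; move: ul ps; rewrite El1 El2 /= inE andbT => zw.
  case/and5P=> _ c1' _ c2' /and3P[_ c3' _].
  split; [by split | split; [by rewrite (col_sym u z) | by rewrite (col_sym u z) |]].
  by left; rewrite (col_sym b) eq_sym.
have [w [v [Pw Pv El2]]] : exists x y, [/\ P x, P y &
    l2 = [:: x; y] \/ exists2 w, ~~ P w & l2 = [:: x; w; y]].
  by apply: segment2 ps2 _ => //; clear -n2 c1 c2 c12; lia.
exists z, w, v; move: ul ps; rewrite El1.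
case: El2 => [->|[t _ ->]]; rewrite /= !inE !negb_or.
  case/and3P=> /andP[zw zv] wv _ /and5P[_ c1' _ c2' /and5P[_ c3' awv c4' /andP[_ _]]].
  split; [by split | split; [by rewrite (col_sym u z) | by rewrite (col_sym u z) |]].
  right; split; rewrite // 1?eq_sym // (col_sym b).
  by move: (col2 u w) (col2 w v) (col2 v b) c3' c4'; clear; lia.
case/and4P=> /and3P[zw _ zv] _ _ _ /and5P[_ c1' _ c2' /and5P[_ c3' _ c4' /and3P[_ c5' _]]].
split; [by split | split; [by rewrite (col_sym u z) | by rewrite (col_sym u z) |]].
left; rewrite (col_sym b).
by move: (col2 u w) (col2 w t) (col2 t v) (col2 v b) c3' c4' c5'; clear; lia.
Qed.

End Alternating.

Lemma ecol_lt (G : sgraph) m (c : edge G -> 'I_m.+1) x y : ecol c x y < m.+1.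
Proof. by rewrite /ecol; case: insub => [e|] //=. Qed.

(** * Bounds on the largest part for two colors *)

Section TwoColors.
Variables (G : sgraph) (c : edge G -> 'I_2).

Lemma sorted_proper_seq (F : {set edge G}) s : is_proper c F -> uniq s -> sorted (sub_adj F) s ->
  proper_seq (@adj G) (ecol c) s.
Proof.
move=> pF; elim: s => // x [|y s] IHs // /andP[xs us] /andP[xy ps].
apply/and3P; split; [exact: sub_adj_adj xy | | exact: IHs].
case: s {IHs us} xs ps => // z s; rewrite !inE !negb_or => /and3P[_ xz _] /andP[yz _].
exact: ecol_proper pF xy yz xz.
Qed.

(* A longest path through r in F covers the component of r, as a proper
   2-colored F has maximal degree 2. *)
Lemma tree_path (V : {set G}) (F : {set edge G}) : is_connected V F -> is_proper c F ->
  exists s, [/\ uniq s, proper_seq (@adj G) (ecol c) s & {subset V <= s}].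
Proof.
move=> [/set0Pn[r rV] conn] pF.
pose Q k := [exists t : k.-tuple G, [&& uniq t, sorted (sub_adj F) t & r \in t]].
have Q1 : Q 1 by apply/existsP; exists [tuple r]; rewrite /= mem_seq1 eqxx.
have Qmax k : Q k -> k <= #|G|.
  case/existsP => t /and3P[ut _ _]; rewrite -(size_tuple t) -(card_uniqP ut).
  exact: max_card.
have [k /existsP[t /and3P[ut st rt]] kmax] := ex_maxnP (ex_intro _ 1 Q1) Qmax.
have longer s : uniq s -> sorted (sub_adj F) s -> {subset t <= s} -> size s <= k.
  move=> us ss ts; apply: kmax; apply/existsP; exists (in_tuple s).
  by rewrite /= us ss ts.
(* If [u] is an end of the longest path, [v] would extend it; otherwise [v] would be a third
   neighbor of [u], and three edges at [u] need three colors. *)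
have closed u v : u \in t -> sub_adj F u v -> v \in t.
  move=> ut' uv; apply/negPn/negP => vt; have vu := uv; rewrite sub_adj_sym in vu.
  have lt_sz (s : seq G) : size s <= k -> size s <> (size t).+1.
    by rewrite size_tuple => sk sE; rewrite sE ltnn in sk.
  case/splitPr: {-1}(tval t) / ut' (erefl (tval t)) => s1 s2 Et.
  have vt1 : v \notin s1 ++ u :: s2 by rewrite -Et.
  have [us ss] : uniq (s1 ++ u :: s2) /\ sorted (sub_adj F) (s1 ++ u :: s2) by rewrite -Et.
  have tE w : w \in t -> w \in s1 ++ u :: s2 by rewrite -Et.
  case: (lastP s1) Et vt1 us ss tE => [|s1' x] Et vt1 us ss tE.
    apply: (@lt_sz (v :: u :: s2)); last by rewrite Et.
    apply: longer; rewrite ?Et /= ?vu //; first by rewrite vt1.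
    by move=> w /tE wt; rewrite inE; apply/orP; right.
  case: s2 => [|y s2] in Et vt1 us ss tE *.
    apply: (@lt_sz (rcons (rcons s1' x ++ [:: u]) v)); last by rewrite size_rcons Et.
    apply: longer; rewrite ?Et.
    - by rewrite rcons_uniq vt1.
    - by move: ss; rewrite headI /= rcons_path last_cat /= uv andbT.
    by move=> w /tE wt; rewrite mem_rcons inE; apply/orP; right.
  rewrite -cats1 -catA /= in vt1 us ss.
  have := drop_sorted (size s1') ss; rewrite drop_size_cat // => /and3P[xu uy _].
  have := drop_uniq (size s1') us; rewrite drop_size_cat // => /and3P[xs2 _ _].
  move: xs2 vt1; rewrite !(inE, mem_cat) !negb_or => /and3P[_ xy _] /and5P[_ vx _ vy _].
  have c1 := ecol_proper pF xu uy xy.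
  have c2 := ecol_proper pF vu uy vy.
  have c3 := ecol_proper pF vu (etrans (sub_adj_sym _ _ _) xu) vx.
  move: c1 c2 c3; rewrite (ecol_sym _ u x).
  by move: (ecol_lt c x u) (ecol_lt c v u) (ecol_lt c u y); clear; lia.
exists t; split=> //; first exact: sorted_proper_seq pF ut st.
move=> v /(conn r v rV)/connectP[p pp ->] {v}.
elim: p r rt pp {rV conn Q Q1 Qmax kmax longer} => //= v p IHp u ut' /andP[uv pp].
by apply: IHp pp; apply: closed uv.
Qed.

Lemma triple_alternation (P : {set G}) x y z : k_proper_coloring 3 c -> #|P| <= 3 ->
  (forall u v, u \notin P -> v \notin P -> ~~ adj u v) ->
  x \notin P -> y \notin P -> z \notin P -> x != y -> y != z -> z != x ->
  exists a u b, perm_eq [:: a; u; b] [:: x; y; z] /\ alternation (@adj G) (ecol c) [in P] a u b.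
Proof.
move=> pc P3 indep xW yW zW xy yz zx.
have [|V [F [[sF cF aF] sV pF]]] := pc [set x; y; z].
  by rewrite -setUA !cardsU1 cards1 !inE negb_or xy (eq_sym x z) zx yz.
have [s [us ps Vs]] := tree_path cF pF.
have sub : {subset [:: x; y; z] <= s}.
  by move=> v; rewrite !inE => vS; apply/Vs/(subsetP sV); rewrite !inE -orbA.
have uS : uniq [:: x; y; z] by rewrite /= !inE negb_or xy (eq_sym x z) zx yz.
(* Filtering the path gives the three vertices in the order in which it visits them. *)
have : perm_eq (filter [in [:: x; y; z]] s) [:: x; y; z].
  apply: uniq_perm; rewrite ?filter_uniq // => v; rewrite mem_filter andb_idr //.
  exact: sub.
move E : (filter _ s) => t pt; have := perm_size pt; case: t E pt => [|a [|u [|b []]]] // E pt _.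
have : subseq [:: a; u; b] s by rewrite -E filter_subseq.
case/subseq_split=> s1 [s2 [Es]] /subseq_split[l1 [s3 [Es2]]] /subseq_split[l2 [s4 [Es3 _]]].
have W v : v \in [:: a; u; b] -> v \notin P.
  by rewrite (perm_mem pt) !inE => /or3P[] /eqP->.
have us' : uniq (l1 ++ l2).
  apply: subseq_uniq us; rewrite Es Es2 Es3.
  apply: subseq_trans (suffix_subseq _ _); apply: subseq_trans (subseq_cons _ _).
  apply: cat_subseq => //; apply: subseq_trans (subseq_cons _ _).
  exact: prefix_subseq.
have cP : count [in P] (l1 ++ l2) <= 3.
  rewrite -size_filter; apply: leq_trans P3; rewrite -(card_uniqP (filter_uniq _ us')).
  by apply/subset_leq_card/subsetP => v; rewrite mem_filter => /andP[].
rewrite Es Es2 Es3 in ps; have ps' := proper_seq_catr ps.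
have indep' u' v' : ~~ [in P] u' -> ~~ [in P] v' -> ~~ adj u' v' by exact: indep.
have Wa := W a (mem_head _ _).
have Wu : u \notin P by apply: W; rewrite !inE eqxx orbT.
have Wb : b \notin P by apply: W; rewrite !inE eqxx !orbT.
have [alt|alt] := proper_seq_alternation indep' (ecol_sym c) (@adj_sym G) (ecol_lt c) Wa Wu Wb ps' us' cP.
  by exists a, u, b.
exists b, u, a; split=> //; apply: perm_trans pt.
by rewrite (_ : [:: b; u; a] = rev [:: a; u; b]) // perm_rev.
Qed.

(** The classes are the colors at [p0]. Within a class, [p] must be [p1], hence [q = r = p0], where
    the colors should differ. *)
Lemma two_hubs_bound (p0 p1 : G) (W : {set G}) : k_proper_coloring 3 c ->
  (forall u v, u \notin [set p0; p1] -> v \notin [set p0; p1] -> ~~ adj u v) ->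
  {in W, forall v, v \notin [set p0; p1]} -> #|W| <= 4.
Proof.
move=> pc indep WP; apply: (@card_classes _ _ _ (fun v => ecol c v p0) [:: 0; 1]) => [v _|].
  by rewrite !inE; move: (ecol_lt c v p0); case: ecol => [|[]].
move=> x y z /WP xP /WP yP /WP zP xy yz zx Exy Eyz.
have P3 : #|[set p0; p1]| <= 3 by rewrite (leq_trans (leq_of_leqif (leq_card_setU _ _))) // !cards1.
have [a [u [b [/perm_mem pS]]]] := triple_alternation pc P3 indep xP yP zP xy yz zx.
have E v : v \in [:: a; u; b] -> ecol c v p0 = ecol c x p0.
  by rewrite pS !inE => /or3P[]/eqP-> //; congruence.
have Ea := E a (mem_head _ _).
have Eu : ecol c u p0 = ecol c x p0 by apply: E; rewrite !inE eqxx orbT.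
have Eb : ecol c b p0 = ecol c x p0 by apply: E; rewrite !inE eqxx !orbT.
case=> p [q [r [[/set2P pP /set2P qP /set2P rP pq pr] [c1 c2 c3]]]].
have Ep : p = p1 by case: pP => // Ep; rewrite Ep Ea Eu eqxx in c1.
have Eq : q = p0 by case: qP => // Eq; rewrite Eq Ep eqxx in pq.
have Er : r = p0 by case: rP => // Er; rewrite Er Ep eqxx in pr.
by case: c3 => [|[]]; rewrite Er Eq ?Eb ?Eu eqxx.
Qed.

Lemma card_set3 (p0 p1 p2 : G) : #|[set p0; p1; p2]| <= 3.
Proof. by rewrite -setUA !cardsU1 cards1; case: (_ \notin _) (_ \notin _) => -[]. Qed.

(** The color at [p0] is dropped when those at [p1] and [p2] agree. In such a class [p] must be
    [p0], so [q] and [r] are among [p1], [p2], where the colors agree; the alternation then needs an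
    edge between [p1] and [p2]. In the other classes the full types agree, which excludes [p]. *)
Lemma path_hubs_bound (p0 p1 p2 : G) (W : {set G}) : k_proper_coloring 3 c ->
  (forall u v, u \notin [set p0; p1; p2] -> v \notin [set p0; p1; p2] -> ~~ adj u v) ->
  ~~ adj p1 p2 ->
  {in W, forall v, v \notin [set p0; p1; p2]} -> #|W| <= 12.
Proof.
move=> pc indep na WP.
pose k v := (ecol c v p1, ecol c v p2, if ecol c v p1 == ecol c v p2 then 0 else ecol c v p0).
apply: (@card_classes _ _ _ k [:: (0, 0, 0); (1, 1, 0); (0, 1, 0); (0, 1, 1); (1, 0, 0); (1, 0, 1)]) => [v _|].
  rewrite /k !inE; move: (ecol_lt c v p0) (ecol_lt c v p1) (ecol_lt c v p2).
  by case: ecol => [|[|?]] //; case: ecol => [|[|?]] //; case: ecol => [|[|?]].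
move=> x y z /WP xP /WP yP /WP zP xy yz zx Exy Eyz.
have [a [u [b [/perm_mem pS]]]] := triple_alternation pc (card_set3 _ _ _) indep xP yP zP xy yz zx.
have E v : v \in [:: a; u; b] -> k v = k x.
  by rewrite pS !inE => /or3P[]/eqP-> //; congruence.
have Ea : k a = k u by rewrite !E ?inE ?eqxx ?orbT.
have Eb : k b = k u by rewrite !E ?inE ?eqxx ?orbT.
case=> p [q [r [[pP qP rP pq pr] [c1 c2 c3]]]].
have set3 w : w \in [set p0; p1; p2] -> [\/ w = p0, w = p1 | w = p2].
  by rewrite !inE -orbA => /or3P[]/eqP->; [constructor 1 | constructor 2 | constructor 3].
move: Ea Eb; rewrite /k => -[a1 a2]; rewrite a1 a2 => a0 [b1 b2 _].
have [Eu|Nu] := eqVneq (ecol c u p1) (ecol c u p2); last first.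
  rewrite (negPf Nu) in a0; case/negP: c1; apply/eqP.
  by case: (set3 _ pP) => ->.
have Ep : p = p0 by case: (set3 _ pP) c1 => // ->; rewrite ?a1 ?a2 eqxx.
have not0 w : w \in [set p0; p1; p2] -> p != w -> [/\ ecol c u w = ecol c u p1, ecol c b w = ecol c u p1 & w = p1 \/ w = p2].
  by rewrite Ep => /set3[] ->; rewrite ?eqxx // => _; split; rewrite ?b1 ?b2 //; auto.
have [uq _ q12] := not0 q qP pq; have [_ br r12] := not0 r rP pr.
case: c3 => [|[rq qr _]]; first by rewrite uq br eqxx.
move: rq qr; case: q12 r12 => -> [] ->; rewrite ?eqxx // 1?adj_sym => _ h; case/negP: na => //.
by rewrite adj_sym.
Qed.

(** The constant types 000 and 111 form one class. The middle vertex [u] sees two different colors,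
    so its type is not constant, and then [a] has the same type as [u], against the choice of
    [p]. *)
Lemma three_hubs_bound (p0 p1 p2 : G) (W : {set G}) : k_proper_coloring 3 c ->
  (forall u v, u \notin [set p0; p1; p2] -> v \notin [set p0; p1; p2] -> ~~ adj u v) ->
  {in W, forall v, v \notin [set p0; p1; p2]} -> #|W| <= 14.
Proof.
move=> pc indep WP.
pose k v := if (ecol c v p0 == ecol c v p1) && (ecol c v p1 == ecol c v p2) then (0, 0, 0)
  else (ecol c v p0, ecol c v p1, ecol c v p2).
apply: (@card_classes _ _ _ k [:: (0, 0, 0); (0, 0, 1); (0, 1, 0); (0, 1, 1);
    (1, 0, 0); (1, 0, 1); (1, 1, 0)]) => [v _|].
  rewrite /k !inE; move: (ecol_lt c v p0) (ecol_lt c v p1) (ecol_lt c v p2).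
  by case: ecol => [|[|?]] //; case: ecol => [|[|?]] //; case: ecol => [|[|?]].
move=> x y z /WP xP /WP yP /WP zP xy yz zx Exy Eyz.
have [a [u [b [/perm_mem pS]]]] := triple_alternation pc (card_set3 _ _ _) indep xP yP zP xy yz zx.
have E v : v \in [:: a; u; b] -> k v = k x.
  by rewrite pS !inE => /or3P[]/eqP-> //; congruence.
have Ea : k a = k u by rewrite !E ?inE ?eqxx ?orbT.
case=> p [q [r [[pP qP _ _ _] [c1 c2 _]]]].
have set3 w : w \in [set p0; p1; p2] -> [\/ w = p0, w = p1 | w = p2].
  by rewrite !inE -orbA => /or3P[]/eqP->; [constructor 1 | constructor 2 | constructor 3].
have flat v : (ecol c v p0 == ecol c v p1) && (ecol c v p1 == ecol c v p2) ->
    {in [set p0; p1; p2], forall w, ecol c v w = ecol c v p0}.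
  by move=> /andP[/eqP e1 /eqP e2] w /set3[] ->; congruence.
have [Fu|Nu] := boolP ((ecol c u p0 == ecol c u p1) && (ecol c u p1 == ecol c u p2)).
  by case/negP: c2; apply/eqP; rewrite !(flat u Fu).
move: Ea; rewrite /k (negPf Nu); case: ifP => _ [e0 e1 e2].
  by rewrite -e0 -e1 -e2 in Nu.
by case/negP: c1; apply/eqP; case: (set3 _ pP) => ->.
Qed.

End TwoColors.

(** * The proper index *)

Section CeilSqrtHalf.
Import Order.TTheory GRing.Theory Num.Theory.
Local Open Scope ring_scope.

(** Identifies the ceiling as the least [k] with [t <= 2 * k ^ 2], the bound from counting types. *)
Lemma ceil_sqrt_half_le (R : realType) (t k : nat) :
  (ceil_sqrt_half R t <= k)%N = (t <= 2 * k ^ 2)%N.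
Proof.
have x0 : 0 <= t%:R / 2%:R :> R by rewrite divr_ge0.
rewrite /ceil_sqrt_half -lez_nat gez0_abs; last first.
  by rewrite ceil_ge0 (lt_le_trans _ (sqrtr_ge0 _)) // ltrN10.
rewrite ceil_le_int -[X in _ <= X]ger0_norm ?ler0n // -sqrtr_sqr ler_sqrt ?sqr_ge0 //.
by rewrite ler_pdivrMr // -natrX -natrM ler_nat mulnC.
Qed.
End CeilSqrtHalf.

Lemma mem_psums (ns : seq nat) k : sumn (take k ns) \in psums ns.
Proof.
have [lk|kl] := leqP k (size ns).
  by apply/mapP; exists k => //; rewrite mem_iota.
rewrite (take_oversize (ltnW kl)) -{1}(take_size ns).
by apply/mapP; exists (size ns); rewrite // mem_iota /=.
Qed.

Section LastPart.
Variables (l : seq nat) (t : nat).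
Let ns := rcons l t.
Let s := sumn l.

Lemma sumn_rcons_psums : s \in psums ns.
Proof. by have := mem_psums ns (size l); rewrite /ns -cats1 take_size_cat. Qed.

Lemma last_part_indep (u v : complete_multipartite ns) :
  s <= vindex u -> s <= vindex v -> ~~ adj u v.
Proof.
have un := vindex_lt u; have vn := vindex_lt v.
rewrite multipartite_adjE => su sv; apply/hasPn => c /mapP[k _ ->].
have [kl|lk] := leqP k (size l).
  have : sumn (take k ns) <= s.
    by have := sumn_take_mono ns kl; rewrite {2}/ns -cats1 take_size_cat.
  by clear -su sv; lia.
have -> : take k ns = ns by rewrite take_oversize // size_rcons.
by clear -un vn; lia.
Qed.

Lemma card_last_part : 0 < s -> t <= #|[set v : complete_multipartite ns | s <= vindex v]|.
Proof.
move=> s0; have n_s : sumn ns = s + t by rewrite sumn_rcons.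
have [g gK] : exists g : nat -> complete_multipartite ns, forall i, i < sumn ns -> vindex (g i) = i.
  by apply: vindex_onto; rewrite n_s; clear -s0; lia.
have gI : injective (fun i : 'I_t => g (s + i)).
  move=> i j /(congr1 (@vindex ns)); rewrite !gK ?n_s ?ltn_add2l // => /addnI; exact: val_inj.
rewrite -[X in X <= _](card_ord t) -(card_imset _ gI); apply/subset_leq_card/subsetP => v.
by case/imsetP => i _ ->; rewrite inE gK ?n_s ?ltn_add2l // leq_addr.
Qed.

End LastPart.

Lemma colorable_index2 (G : sgraph) : 2 < #|G| -> colorable G 2 -> is_proper_index 3 G 2.
Proof. by move=> G3 cG; split=> // m' c; apply: proper_coloring_ge2. Qed.

Lemma card_multipartite ns : 2 < sumn ns -> 2 < #|complete_multipartite ns|.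
Proof.
move=> n3; have [g gK] := vindex_onto (ltn_trans (isT : 0 < 2) n3).
have gI : injective (fun i : 'I_3 => g i).
  move=> i j /(congr1 (@vindex ns)); rewrite !gK ?(leq_trans (ltn_ord _)) //; exact: val_inj.
by rewrite -[X in X <= _](card_ord 3) -(card_imset _ gI) max_card.
Qed.

Lemma table_colorable ns cuts : 0 < sumn ns -> {subset cuts <= psums ns} ->
  (sumn ns, cuts) \in table_graphs ->
  colorable (complete_multipartite ns) 2.
Proof. by move=> n0 sub /table_coloring; apply: cut_coloring_colorable. Qed.

Lemma cut3_colorable ns : 6 <= sumn ns <= 15 -> 3 \in psums ns ->
  colorable (complete_multipartite ns) 2.
Proof.
move=> n6 c3; apply: (@table_colorable _ [:: 3]).
- by clear -n6; lia.
- by move=> c; rewrite inE => /eqP->.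
by rewrite mem_cat map_f // mem_iota; clear -n6; lia.
Qed.

Lemma rev_cut3_colorable ns : 6 <= sumn ns <= 15 -> sumn ns - 3 \in psums ns ->
  colorable (complete_multipartite ns) 2.
Proof.
move=> n6 c3; apply: (@rev_cut_coloring_colorable _ [:: 3] _ table_col).
- by clear -n6; lia.
- by move=> c; rewrite /= inE => /eqP->.
- by rewrite /=; clear -n6; lia.
by apply: table_coloring; rewrite mem_cat map_f // mem_iota; clear -n6; lia.
Qed.

Lemma cut4_colorable ns p : p \in psums ns -> 4 <= p -> p + 4 <= sumn ns ->
  colorable (complete_multipartite ns) 2.
Proof.
move=> pp p4 pn; apply: (@cut_coloring_colorable _ [:: p]); last exact: c4_coloring p4 pn.
  by clear -p4 pn; lia.
by move=> c; rewrite inE => /eqP->.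
Qed.

(** If [t < 4], the first prefix sum [p >= 4] is tried as a cut. Should fewer than four vertices
    remain behind it, there are at most [p0 + t + 3 <= 9] vertices, where [p0 <= 3] is the prefix
    sum before [p], and the tables apply. *)
Lemma large_rest_colorable l t : sorted leq (rcons l t) -> 0 < t -> 4 <= sumn l ->
  colorable (complete_multipartite (rcons l t)) 2.
Proof.
set ns := rcons l t => srt t0 l4.
have n_t : sumn ns = sumn l + t by rewrite sumn_rcons.
have sP : sumn l \in psums ns := sumn_rcons_psums l t.
have [t4|t4] := leqP 4 t; first by apply: (cut4_colorable sP); rewrite // n_t; clear -t4; lia.
have nth_t k : nth 0 ns k <= t.
  have [kn|kn] := ltnP k (size ns); last by rewrite nth_default.
  have : t = nth 0 ns (size l) by rewrite nth_rcons ltnn eqxx.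
  move=> E; rewrite [X in _ <= X]E; apply: (sorted_leq_nth leq_trans leqnn) => //; rewrite ?inE ?size_rcons //.
  by rewrite size_rcons in kn.
have tl : take (size l) ns = l by rewrite /ns -cats1 take_size_cat.
have ex : exists k, 4 <= sumn (take k ns) by exists (size l); rewrite tl.
case: (ex_minnP ex) => k; case: k => [|k]; first by rewrite take0.
move=> p4 kmin; have p03 : sumn (take k ns) <= 3.
  by rewrite leqNgt; apply/negP => /kmin; rewrite ltnn.
have ps : sumn (take k.+1 ns) <= sumn l.
  by rewrite -[X in _ <= sumn X]tl; apply: sumn_take_mono; apply: kmin; rewrite tl.
have pE : sumn (take k.+1 ns) <= sumn (take k ns) + t.
  have [kn|kn] := ltnP k (size ns).
    by rewrite (take_nth 0) // sumn_rcons leq_add2l.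
  by rewrite !take_oversize ?leq_addr // ltnW.
have := mem_psums ns k; have := mem_psums ns k.+1.
move: (sumn (take k ns)) (sumn (take k.+1 ns)) p4 p03 ps pE => p0 p p4 p03 ps pE pP p0P.
have [pn|pn] := leqP (p + 4) (sumn ns); first exact: cut4_colorable pP p4 pn.
have [t3|t3] := eqVneq t 3.
  apply: rev_cut3_colorable; first by rewrite n_t in pn *; clear -t3 pn pE p03 l4; lia.
  by rewrite n_t t3 addnK.
have [p3|p3] := eqVneq p0 3.
  rewrite p3 in p0P; have [n6|n6] := leqP 6 (sumn ns).
    by apply: cut3_colorable => //; clear -n6 pn pE p3 t4; lia.
  have n5 : sumn ns = 5 by rewrite n_t in n6 *; clear -n6 l4 t0; lia.
  have pp : p = 4 by rewrite n_t in n5; clear -n5 t0 ps p4; lia.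
  apply: (@table_colorable _ [:: 3; 4]); rewrite ?n5 //.
  by move=> c; rewrite !inE => /orP[]/eqP-> //; rewrite -pp.
(* [p0] and [t] are now at most 2, but [p <= p0 + t] is at least 4. *)
have [pp [pp0 t2]] : p = 4 /\ p0 = 2 /\ t = 2 by clear -p3 p03 t3 t4 pE p4; lia.
have [n7|n7] := eqVneq (sumn ns) 7.
  by apply: rev_cut3_colorable; rewrite n7 // (_ : 7 - 3 = p).
have n6 : sumn ns = 6 by clear -n_t pn ps t2 pp n7; lia.
apply: (@table_colorable _ [:: 2; 4]); rewrite ?n6 //.
by move=> c; rewrite !inE => /orP[]/eqP->; rewrite -?pp -?pp0.
Qed.

Lemma two_hubs ns : 2 <= sumn ns -> exists p0 p1 : complete_multipartite ns,
  forall v, (v \notin [set p0; p1]) = (2 <= vindex v).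
Proof.
move=> n2; have [g gK] := vindex_onto (ltn_trans (isT : 0 < 1) n2).
have gE v i : i < sumn ns -> (v == g i) = (vindex v == i).
  by move=> /gK {2}<-; rewrite (inj_eq (@vindex_inj ns)).
exists (g 0), (g 1) => v; rewrite !inE (gE _ 0 (ltnW n2)) (gE _ 1 n2).
by clear; lia.
Qed.

Lemma three_hubs ns : 3 <= sumn ns -> exists p0 p1 p2 : complete_multipartite ns,
  [/\ vindex p1 = 1, vindex p2 = 2 &
      forall v, (v \notin [set p0; p1; p2]) = (3 <= vindex v)].
Proof.
move=> n3; have [g gK] := vindex_onto (ltn_trans (isT : 0 < 2) n3).
have gE v i : i < sumn ns -> (v == g i) = (vindex v == i).
  by move=> /gK {2}<-; rewrite (inj_eq (@vindex_inj ns)).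
exists (g 0), (g 1), (g 2); split; rewrite ?gK ?(ltnW n3) // => v.
by rewrite !inE (gE _ 0 (ltnW (ltnW n3))) (gE _ 1 (ltnW n3)) (gE _ 2 n3); clear; lia.
Qed.

(** * The three families with at most three vertices outside the largest part *)

Section Index.
Variable t : nat.
Hypothesis t0 : 0 < t.

Lemma k11t_bound m (c : edge (complete_multipartite [:: 1; 1; t]) -> 'I_m) :
  k_proper_coloring 3 c -> t <= 2 * m ^ 2.
Proof.
move=> pc; have [p0 [p1 pP]] := @two_hubs [:: 1; 1; t] isT.
apply: leq_trans (@card_last_part [:: 1; 1] t isT) _; rewrite -mulnn.
have -> : m * m = size (allpairs pair (iota 0 m) (iota 0 m)) by rewrite size_allpairs !size_iota.
(* As [m] might be 0, the bound needs an actual edge. *)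
have ecol_m u v : adj u v -> ecol c u v < m.
  move=> uv; pose e : edge _ := exist _ [set u; v] (mem_edges uv).
  by rewrite (@ecolE _ _ c e).
have hub_adj v p : 2 <= vindex v -> p \in [set p0; p1] -> adj v p.
  move=> v2; rewrite -[p \in _]negbK pP -ltnNge => p2.
  rewrite multipartite_adjE; apply/hasP; exists 2; first by rewrite !inE.
  by rewrite v2; clear -p2; lia.
apply: (@card_classes _ _ _ (fun v => (ecol c v p0, ecol c v p1))) => [v|x y z].
  rewrite inE => v2; apply/allpairsP; exists (ecol c v p0, ecol c v p1).
  by rewrite !mem_iota /= !ecol_m // hub_adj // !inE eqxx ?orbT.
rewrite !inE => x2 y2 z2 xy yz zx [e1 e2] [e3 e4].
apply: (@same_type_two_hubs _ _ c p0 p1 x y z) => //; rewrite ?pP // => u v.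
by rewrite !pP; apply: (@last_part_indep [:: 1; 1] t).
Qed.

Lemma k11t_bound2 (c : edge (complete_multipartite [:: 1; 1; t]) -> 'I_2) :
  k_proper_coloring 3 c -> t <= 4.
Proof.
move=> pc; have [p0 [p1 pP]] := @two_hubs [:: 1; 1; t] isT.
apply: leq_trans (@card_last_part [:: 1; 1] t isT) _.
apply: (@two_hubs_bound _ _ p0 p1 _ pc) => [u v|v]; last by rewrite inE pP.
by rewrite !pP; apply: (@last_part_indep [:: 1; 1] t).
Qed.

Lemma k12t_bound2 (c : edge (complete_multipartite [:: 1; 2; t]) -> 'I_2) :
  k_proper_coloring 3 c -> t <= 12.
Proof.
move=> pc; have [p0 [p1 [p2 [v1 v2 pP]]]] := @three_hubs [:: 1; 2; t] isT.
apply: leq_trans (@card_last_part [:: 1; 2] t isT) _.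
apply: (@path_hubs_bound _ _ p0 p1 p2 _ pc) => [u v||v]; last by rewrite inE pP.
  by rewrite !pP; apply: (@last_part_indep [:: 1; 2] t).
by rewrite multipartite_adjE v1 v2.
Qed.

Lemma k111t_bound2 (c : edge (complete_multipartite [:: 1; 1; 1; t]) -> 'I_2) :
  k_proper_coloring 3 c -> t <= 14.
Proof.
move=> pc; have [p0 [p1 [p2 [_ _ pP]]]] := @three_hubs [:: 1; 1; 1; t] isT.
apply: leq_trans (@card_last_part [:: 1; 1; 1] t isT) _.
apply: (@three_hubs_bound _ _ p0 p1 p2 _ pc) => [u v|v]; last by rewrite inE pP.
by rewrite !pP; apply: (@last_part_indep [:: 1; 1; 1] t).
Qed.

Lemma index3 (G : sgraph) : 2 < #|G| -> colorable G 3 ->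
  (forall c : edge G -> 'I_2, ~ k_proper_coloring 3 c) -> is_proper_index 3 G 3.
Proof.
move=> G3 cG no2; split=> // m' c pc; have := proper_coloring_ge2 G3 pc.
by rewrite leq_eqVlt => /orP[/eqP m2 |//]; case: m' / m2 c pc => c /no2.
Qed.

Lemma latin_colorable ns : 12 <= sumn ns -> 3 \in psums ns ->
  colorable (complete_multipartite ns) 3.
Proof.
move=> n12 c3; apply: (@cut_coloring_colorable _ [:: 3]); last exact: latin_coloring n12.
  by clear -n12; lia.
by move=> c; rewrite inE => /eqP->.
Qed.

Lemma k11t_colorable m : 3 <= m -> m * m.-1 <= t -> t <= 2 * m ^ 2 ->
  colorable (complete_multipartite [:: 1; 1; t]) m.
Proof.
move=> m3 m_t t_m; have sE : sumn [:: 1; 1; t] = t + 2 by rewrite /= addn0 !add1n addn2.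
apply: (@cut_coloring_colorable _ [:: 1; 2]) (latin_pair_coloring m3 _ _); rewrite ?sE ?leq_add2r ?addn2 //.
by move=> c; rewrite !inE => /orP[]/eqP->.
Qed.

Lemma k11t_small : t <= 4 -> colorable (complete_multipartite [:: 1; 1; t]) 2.
Proof.
move=> t4; have [|col nc] := @small_pair_coloring t; first by rewrite t0.
apply: (@cut_coloring_colorable _ [:: 1; 2] _ col) => //.
  by move=> c; rewrite !inE => /orP[]/eqP->.
by rewrite (_ : sumn _ = t + 2) //= addn0 !add1n addn2.
Qed.

Lemma k115_colorable : colorable (complete_multipartite [:: 1; 1; 5]) 3.
Proof.
have [col nc] := five_pair_coloring.
by apply: (@cut_coloring_colorable _ [:: 1; 2] _ col) => // c; rewrite !inE => /orP[]/eqP->.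
Qed.

Lemma k12t_colorable2 : 2 <= t <= 12 -> colorable (complete_multipartite [:: 1; 2; t]) 2.
Proof.
move=> t2; have [t3|t3] := leqP 3 t.
  by apply: cut3_colorable => //=; clear -t2 t3; lia.
have -> : t = 2 by clear -t2 t3; lia.
by apply: (@table_colorable _ [:: 1; 3]) => // c; rewrite !inE => /orP[]/eqP->.
Qed.

(** The subgraph $K_{3,t}$ suffices for [3 <= t <= 12]; the other four values use the table with all
    three hubs in separate parts. *)
Lemma k111t_colorable2 : t <= 14 -> colorable (complete_multipartite [:: 1; 1; 1; t]) 2.
Proof.
move=> t14; have [/andP[t3 t12]|nt] := boolP (3 <= t <= 12).
  by apply: cut3_colorable => //=; clear -t3 t12; lia.
have : t \in [:: 1; 2; 13; 14] by rewrite !inE; clear -t14 nt t0; lia.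
by rewrite !inE => /or4P[]/eqP->; apply: (@table_colorable _ [:: 1; 2; 3]) => // c;
  rewrite !inE => /or3P[]/eqP->.
Qed.

End Index.

Lemma k11t_index (R : realType) t : 0 < t ->
  is_proper_index 3 (complete_multipartite [:: 1; 1; t])
    (if 5 <= t <= 18 then 3 else if 19 <= t then ceil_sqrt_half R t else 2).
Proof.
move=> t0; have V3 : 2 < #|complete_multipartite [:: 1; 1; t]|.
  by apply: card_multipartite; rewrite /= addn0 -[2]/(1 + 1) addnA ltn_add2l.
case: ifP => [t5|t5].
  apply: index3 => // [|c /k11t_bound2]; last by clear -t5; lia.
  have [->|t6] := eqVneq t 5; first exact: k115_colorable.
  by apply: k11t_colorable => //; clear -t5 t6; lia.
case: ifP => [t19|t19]; last by apply: colorable_index2 => //; apply: k11t_small => //; clear -t5 t19; lia.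
split=> [|m' c /k11t_bound]; last by rewrite ceil_sqrt_half_le.
have := ceil_sqrt_half_le R t (ceil_sqrt_half R t); rewrite leqnn => /esym t_le.
have := ceil_sqrt_half_le R t (ceil_sqrt_half R t).-1.
move: (ceil_sqrt_half R t) t_le => m t_le.
(* [t >= 19] exceeds [2 * 3 ^ 2 = 18]. *)
have m3 : 3 < m by rewrite ltnNge; apply/negP => m3; move: t_le; have := leq_mul m3 m3; rewrite mulnn; clear -t19; lia.
rewrite leqNgt prednK ?(ltn_trans _ m3) // leqnn => /esym/negbT; rewrite -ltnNge => t_gt.
apply: k11t_colorable => //; first exact: ltnW.
(* Minimality of [m] gives [2 * (m - 1) ^ 2 < t], and [m <= 2 * (m - 1)], so all pairs of distinct
   colors fit. *)
apply: leq_trans (ltnW t_gt); rewrite -mulnn mulnA leq_mul2r; apply/orP; right.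
by clear -m3; lia.
Qed.

Theorem theorem8 (R : realType) (ns : seq nat)
    (hr : 3 <= size ns)
    (hpos : all (fun n => 1 <= n) ns)
    (hsorted : sorted leq ns) :
  let t := last 0 ns in
  is_proper_index 3 (complete_multipartite ns)
    (if [|| (ns == [:: 1; 1; t]) && (5 <= t <= 18),
            (ns == [:: 1; 2; t]) && (13 <= t)
          | (ns == [:: 1; 1; 1; t]) && (15 <= t)] then 3
     else if (ns == [:: 1; 1; t]) && (19 <= t) then ceil_sqrt_half R t
     else 2).
Proof.
case: (lastP ns) hr hpos hsorted => // l t; rewrite size_rcons last_rcons all_rcons.
move=> l2 /andP[t0 lpos] srt /=.
have V3 : 2 < #|complete_multipartite (rcons l t)|.
  apply: card_multipartite; rewrite sumn_rcons -addn1 leq_add //.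
  case: l l2 lpos {srt} => [|a [|b l]] //= _ /and3P[a0 b0 _].
  by clear -a0 b0; lia.
have [l4|l4] := leqP 4 (sumn l).
  have ne l' : sumn l' < 4 -> (rcons l t == rcons l' t) = false.
    by move=> l'4; apply/negbTE; apply: contraTneq l4 => /rcons_inj[->]; rewrite -ltnNge.
  rewrite (ne [:: 1; 1]) // (ne [:: 1; 2]) // (ne [:: 1; 1; 1]) //.
  by apply: colorable_index2 => //; apply: large_rest_colorable.
have : l \in [:: [:: 1; 1]; [:: 1; 2]; [:: 1; 1; 1]].
  case: l l2 lpos srt l4 {V3} => [|a [|b [|d [|e l]]]] //=.
  - move=> _ /and3P[a0 b0 _] /andP[ab _] l4.
    have : (a == 1) && (b == 1) || (a == 1) && (b == 2) by clear -a0 b0 ab l4; lia.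
    by case/orP=> /andP[/eqP-> /eqP->].
  - move=> _ /and4P[a0 b0 d0 _] _ l4.
    have : [&& a == 1, b == 1 & d == 1] by clear -a0 b0 d0 l4; lia.
    by case/and3P=> /eqP-> /eqP-> /eqP->.
  by move=> _ /and5P[a0 b0 d0 e0 _] _ l4; clear -a0 b0 d0 e0 l4; lia.
rewrite !inE => /or3P[] /eqP El; rewrite El /= in V3 *.
- rewrite eqxx /= !eqseq_cons /= !andbF !orbF; exact: k11t_index.
- rewrite !eqseq_cons !eqxx /= !orbF; case: ifP => t13.
    apply: index3 => // [|c /k12t_bound2]; last by clear -t13; lia.
    by apply: latin_colorable => //=; clear -t13; lia.
  apply: colorable_index2 => //; apply: k12t_colorable2.
  (* Sortedness gives [2 <= t]. *)
  move: srt; rewrite El /= andbT => t2; clear -t2 t13; lia.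
rewrite !eqseq_cons !eqxx /= !andbF /=; case: ifP => t15.
  apply: index3 => // [|c /k111t_bound2]; last by clear -t15; lia.
  by apply: latin_colorable => //=; clear -t15; lia.
by apply: colorable_index2 => //; apply: k111t_colorable2 => //; clear -t15; lia.
Qed.
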